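(* Assume (H1) and (H2) (stated in the context). Fix any feasible solution $(\bar x(\cdot),\bar y(\cdot),\bar u(\cdot),\bar a(\cdot),\bar b(\cdot))$ to $(P)$ such that the velocity functions $\dot{\bar x}(\cdot)$ and $\dot{\bar u}(\cdot)$ are of bounded variation on $[0,T]$, i.e. there is $\mu>0$ with $$\max\{\mathrm{var}(\dot{\bar x}(\cdot),[0,T]),\ \mathrm{var}(\dot{\bar u}(\cdot),[0,T])\}\le\mu .$$ Given, for each $k\in\mathbb{N}$, the discrete mesh $\Delta_k=\{0=t^k_0<t^k_1<\dots<t^k_k=T\}$ with $t^k_{j+1}-t^k_j\le h_k:=T/k$ for $j=0,\dots,k-1$, there exist sequences of functions $(x^k(\cdot),y^k(\cdot),u^k(\cdot),a^k(\cdot),b^k(\cdot))$ on $[0,T]$, piecewise linear with respect to $\Delta_k$, such that $(x^k(0),y^k(0),u^k(0),a^k(0),b^k(0))=(x_0,0,\bar u(0),\bar a(0),\bar b(0))$ for all $k\in\mathbb{N}$, and $$x^k(t)=x^k(t^k_j)+(t-t^k_j)\upsilon^k_j,\quad y^k(t)=y^k(t^k_j)+(t-t^k_j)w^k_j,\qquad t\in[t^k_j,t^k_{j+1}],\ j=0,\dots,k-1,$$ where the discrete velocities satisfy, for $j=0,\dots,k-1$, $$-\upsilon^k_j\in F_1\big(x^k(t^k_j),y^k(t^k_{j+1}),u^k(t^k_j),a^k(t^k_j)\big),\qquad w^k_j=f_2\big(b^k(t^k_j),x^k(t^k_j)\big),$$ with $F_1(x,y,u,a):=N_{C(u)}(x)+f_1(a,x)+y$.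 Furthermore, $$(x^k(\cdot),y^k(\cdot),u^k(\cdot),a^k(\cdot),b^k(\cdot))\to(\bar x(\cdot),\bar y(\cdot),\bar u(\cdot),\bar a(\cdot),\bar b(\cdot))\quad\text{as }k\to\infty$$ in the norm of $W^{1,2}([0,T],\mathbb{R}^{3n+m+d})$.
   Context: $T>0$ is fixed; $g_1,\dots,g_s:\mathbb{R}^n\to\mathbb{R}$, $C:=\{x\in\mathbb{R}^n: g_i(x)\ge 0,\ i=1,\dots,s\}$, $C(u):=C+u$, and given $u(\cdot)$, $C(t):=C(u(t))$. Further $f_1:\mathbb{R}^{m+n}\to\mathbb{R}^n$, $f_2:\mathbb{R}^{d+n}\to\mathbb{R}^n$, and $x_0\in\mathbb{R}^n$ is fixed. Normal cone: for $\Omega\subset\mathbb{R}^n$ closed and $\bar x\in\Omega$, $N_\Omega(\bar x)$ is the set of $v$ for which there are $x_k\to\bar x$, $w_k$ in the Euclidean projection set $\Pi_\Omega(x_k)$, and $\alpha_k\ge 0$ with $\alpha_k(x_k-w_k)\to v$; $N_\Omega(\bar x):=\emptyset$ for $\bar x\notin\Omega$. A feasible solution to $(P)$ is a quintuple $(x,y,u,a,b)\in W^{1,2}([0,T],\mathbb{R}^{3n+m+d})$ with $$-\dot x(t)\in N_{C(u(t))}(x(t))+f_1(a(t),x(t))+y(t),\quad \dot y(t)=f_2(b(t),x(t))\ \text{ a.e. }t\in[0,T],\quad x(0)=x_0\in C(0),\ y(0)=0.$$ (H1) There are $c>0$, $M_1,M_2,M_3>0$ and open sets $A_i\subset V_i$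 ($i=1,\dots,s$) with $C\subset A_i$ and $d_H(A_i,\mathbb{R}^n\setminus V_i)>c$ ($d_H$ the Hausdorff distance) such that each $g_i$ is twice continuously differentiable with $M_1\le\|\nabla g_i(x)\|\le M_2$ and $\|\nabla^2 g_i(x)\|\le M_3$ for all $x\in V_i$. Furthermore there are $\beta,\rho>0$ with $\sum_{i\in I_\rho(x)}\lambda_i\|\nabla g_i(x)\|\le\beta\big\|\sum_{i\in I_\rho(x)}\lambda_i\nabla g_i(x)\big\|$ whenever $x\in C$ and $\lambda_i\ge 0$, where $I_\rho(x):=\{i: g_i(x)\le\rho\}$. (H2) $f_1,f_2$ are continuous and: (i) there exist $\alpha_1,\alpha_2\ge 0$ such that for control functions $(u,a,b)\in W^{1,2}([0,T],\mathbb{R}^{n+m+d})$ one has $\|f_1(a(t),x)\|\le\|a(t)\|+\alpha_1\|x\|$ and $\|f_2(b(t),x)\|\le\|b(t)\|+\alpha_2\|x\|$ for all $t\in[0,T]$, $x\in\bigcup_{\tau\in[0,T]}C(u(\tau))$; (ii) for any $r_1>0$ and $(a(\cdot),b(\cdot))\in W^{1,2}([0,T],\mathbb{R}^{m+d})$ there exist $L,L_1,L_2\ge 0$ with $\|f_1(a(t),x_1)-f_1(a(t),x_2)\|\le L\|x_1-x_2\|$ and $\|f_2(b(t),x_1)-f_2(b(t),x_2)\|\le L_1\|x_1-x_2\|$ for all $t\in[0,T]$, $\|x_1\|,\|x_2\|\le r_1$, and $\|f_2(b_1,x)-f_2(b_2,x)\|\le L_2\|b_1-b_2\|$ for all $b_1,b_2\in\mathbb{R}^d$,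 $\|x\|\le r_1$. *)

(* Defs.v *)
From HB Require Import structures.
From mathcomp Require Import all_boot all_order all_algebra.
From mathcomp Require Import all_classical all_reals all_analysis.

Set Implicit Arguments.
Unset Strict Implicit.
Unset Printing Implicit Defensive.

Import Order.TTheory GRing.Theory Num.Theory.
Import numFieldNormedType.Exports.

Local Open Scope classical_set_scope.
Local Open Scope ring_scope.

(* The library norm on 'rV[R]_n is the sup norm; it is used here only through
   the topology it induces.  All norms of the statement are Euclidean. *)
Definition enorm (R : realType) (n : nat) (v : 'rV[R]_n) : R :=
  Num.sqrt (\sum_(i < n) v 0 i ^+ 2).

Definition opnorm (R : realType) (n : nat) (A : 'M[R]_n) : R :=
  sup [set enorm (v *m A) | v in [set v : 'rV[R]_n | enorm v <= 1]].

Definition grad (R : realType) (n : nat) (g : 'rV[R]_n -> R) (x : 'rV[R]_n) :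
  'rV[R]_n := \row_j 'D_(delta_mx 0 j) g x.

Definition hess (R : realType) (n : nat) (g : 'rV[R]_n -> R) (x : 'rV[R]_n) :
  'M[R]_n := jacobian (grad g) x.

(* Meaningful for open V. *)
Definition C2_on (R : realType) (n : nat) (V : set 'rV[R]_n)
    (g : 'rV[R]_n -> R) : Prop :=
  forall x, V x ->
    [/\ differentiable g x, differentiable (grad g) x
      & {for x, continuous (hess g)}].

(* Extended-valued, so that the distance to the empty set is +oo. *)
Definition set_dist (R : realType) (n : nat) (x : 'rV[R]_n)
    (A : set 'rV[R]_n) : \bar R :=
  ereal_inf [set (enorm (x - a))%:E | a in A].

Definition hausdorff (R : realType) (n : nat) (A B : set 'rV[R]_n) : \bar R :=
  maxe (ereal_sup [set set_dist a B | a in A])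
       (ereal_sup [set set_dist b A | b in B]).

Definition proj (R : realType) (n : nat) (Om : set 'rV[R]_n) (x : 'rV[R]_n) :
  set 'rV[R]_n :=
  [set w | Om w /\ forall z, Om z -> enorm (x - w) <= enorm (x - z)].

Definition normal_cone (R : realType) (n : nat) (Om : set 'rV[R]_n)
    (xb : 'rV[R]_n) : set 'rV[R]_n :=
  [set v | Om xb /\
    exists (x w : nat -> 'rV[R]_n) (alpha : nat -> R),
      [/\ x k @[k --> \oo] --> xb,
          forall k, proj Om (x k) (w k),
          forall k, 0 <= alpha k
        & alpha k *: (x k - w k) @[k --> \oo] --> v]].

Definition Cset (R : realType) (n s : nat) (g : 'I_s -> 'rV[R]_n -> R) :
  set 'rV[R]_n := [set x | forall i, 0 <= g i x].

Definition Cmov (R : realType) (n s : nat) (g : 'I_s -> 'rV[R]_n -> R)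
    (u : 'rV[R]_n) : set 'rV[R]_n := [set x + u | x in Cset g].

Definition F1 (R : realType) (n m s : nat) (g : 'I_s -> 'rV[R]_n -> R)
    (f1 : 'rV[R]_m -> 'rV[R]_n -> 'rV[R]_n)
    (x y u : 'rV[R]_n) (a : 'rV[R]_m) : set 'rV[R]_n :=
  [set v + f1 a x + y | v in normal_cone (Cmov g u) x].

(* W^{1,2}([0,T]; R^p): arcs that are a.e. differentiable with square
   integrable velocity and that are the integral of their velocity.  Functions
   are total on R, but only their values on [0,T] matter: the library
   derivative at interior points depends on nothing else, and the two endpoints
   are negligible. *)
Definition W12 (R : realType) (p : nat) (T : R) (z : R -> 'rV[R]_p) : Prop :=
  [/\ {ae lebesgue_measure, forall t : R, t \in `[0, T] -> derivable z t 1},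
      forall i, measurable_fun `[0, T] (fun t : R => derive1 z t 0 i),
      (\int[lebesgue_measure]_(t in `[0%R, T]) ((enorm (derive1 z t)) ^+ 2)%:E
         < +oo)%E
    & forall t, t \in `[0, T] -> forall i,
        z t 0 i = z 0 0 i
          + \int[lebesgue_measure]_(r in `[0, t]) (derive1 z r 0 i)].

Definition W12norm (R : realType) (p : nat) (T : R) (z : R -> 'rV[R]_p) :
  \bar R :=
  ((\int[lebesgue_measure]_(t in `[0%R, T]) ((enorm (z t)) ^+ 2)%:E
    + \int[lebesgue_measure]_(t in `[0%R, T]) ((enorm (derive1 z t)) ^+ 2)%:E)
     `^ 2^-1)%E.

Definition W12_cvg (R : realType) (p : nat) (T : R)
    (z_ : nat -> R -> 'rV[R]_p) (z : R -> 'rV[R]_p) : Prop :=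
  [/\ \forall k \near \oo, W12 T (z_ k), W12 T z
    & W12norm T (z_ k \- z) @[k --> \oo] --> 0%E].

Definition triple (R : realType) (n m d : nat) (u : R -> 'rV[R]_n)
    (a : R -> 'rV[R]_m) (b : R -> 'rV[R]_d) (t : R) : 'rV[R]_(n + m + d) :=
  row_mx (row_mx (u t) (a t)) (b t).

Definition quintuple (R : realType) (n m d : nat) (x y u : R -> 'rV[R]_n)
    (a : R -> 'rV[R]_m) (b : R -> 'rV[R]_d) (t : R) :
  'rV[R]_(n + n + n + m + d) :=
  row_mx (row_mx (row_mx (row_mx (x t) (y t)) (u t)) (a t)) (b t).

(* Same conventions as the library's [variation] and [total_variation], which
   are restricted to real-valued functions. *)
Definition vvariation (R : realType) (p : nat) (a b : R) (f : R -> 'rV[R]_p)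
    (s : seq R) : R :=
  let F := f \o nth b (a :: s) in
  \sum_(0 <= k < size s) enorm (F k.+1 - F k).

Definition vtotal_variation (R : realType) (p : nat) (a b : R)
    (f : R -> 'rV[R]_p) : \bar R :=
  ereal_sup [set (vvariation a b f s)%:E | s in itv_partition a b].

(* A velocity is only determined a.e.; this says that w is one of its
   everywhere defined representatives on [0,T]. *)
Definition velocity_rep (R : realType) (p : nat) (T : R)
    (z w : R -> 'rV[R]_p) : Prop :=
  {ae lebesgue_measure, forall t : R, t \in `[0, T] -> derive1 z t = w t}.

Definition H1 (R : realType) (n s : nat) (g : 'I_s -> 'rV[R]_n -> R) : Prop :=
  (exists (c M1 M2 M3 : R) (A V : 'I_s -> set 'rV[R]_n),
    [/\ 0 < c, 0 < M1, 0 < M2 & 0 < M3] /\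
    forall i : 'I_s,
      [/\ open (A i) /\ open (V i),
          A i `<=` V i /\ Cset g `<=` A i,
          (c%:E < hausdorff (A i) (~` V i))%E,
          C2_on (V i) (g i)
        & forall x, V i x ->
            M1 <= enorm (grad (g i) x) <= M2 /\ opnorm (hess (g i) x) <= M3])
  /\
  (exists beta rho : R,
    [/\ 0 < beta, 0 < rho
      & forall (x : 'rV[R]_n) (lambda : 'I_s -> R),
          Cset g x -> (forall i, 0 <= lambda i) ->
          \sum_(i < s | g i x <= rho) lambda i * enorm (grad (g i) x)
          <= beta *
             enorm (\sum_(i < s | g i x <= rho) lambda i *: grad (g i) x)]).

Definition H2 (R : realType) (n m d s : nat) (T : R)
    (g : 'I_s -> 'rV[R]_n -> R)
    (f1 : 'rV[R]_m -> 'rV[R]_n -> 'rV[R]_n)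
    (f2 : 'rV[R]_d -> 'rV[R]_n -> 'rV[R]_n) : Prop :=
  [/\ continuous (fun p : 'rV[R]_m * 'rV[R]_n => f1 p.1 p.2),
      continuous (fun p : 'rV[R]_d * 'rV[R]_n => f2 p.1 p.2),
      exists alpha1 alpha2 : R,
        [/\ 0 <= alpha1, 0 <= alpha2
          & forall (u : R -> 'rV[R]_n) (a : R -> 'rV[R]_m) (b : R -> 'rV[R]_d),
              W12 T (triple u a b) ->
              forall (t : R) (x : 'rV[R]_n), t \in `[0, T] ->
                (exists2 tau, tau \in `[0, T] & Cmov g (u tau) x) ->
                enorm (f1 (a t) x) <= enorm (a t) + alpha1 * enorm x /\
                enorm (f2 (b t) x) <= enorm (b t) + alpha2 * enorm x]
    & forall (r1 : R) (a : R -> 'rV[R]_m) (b : R -> 'rV[R]_d),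
        0 < r1 -> W12 T (fun t => row_mx (a t) (b t)) ->
        exists L L1 L2 : R,
          [/\ 0 <= L, 0 <= L1, 0 <= L2,
              forall (t : R) (x1 x2 : 'rV[R]_n), t \in `[0, T] ->
                enorm x1 <= r1 -> enorm x2 <= r1 ->
                enorm (f1 (a t) x1 - f1 (a t) x2) <= L * enorm (x1 - x2) /\
                enorm (f2 (b t) x1 - f2 (b t) x2) <= L1 * enorm (x1 - x2)
            & forall (b1 b2 : 'rV[R]_d) (x : 'rV[R]_n), enorm x <= r1 ->
                enorm (f2 b1 x - f2 b2 x) <= L2 * enorm (b1 - b2)]].

Definition feasible (R : realType) (n m d s : nat) (T : R)
    (g : 'I_s -> 'rV[R]_n -> R)
    (f1 : 'rV[R]_m -> 'rV[R]_n -> 'rV[R]_n)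
    (f2 : 'rV[R]_d -> 'rV[R]_n -> 'rV[R]_n) (x0 : 'rV[R]_n)
    (x y u : R -> 'rV[R]_n) (a : R -> 'rV[R]_m) (b : R -> 'rV[R]_d) : Prop :=
  [/\ W12 T (quintuple x y u a b),
      {ae lebesgue_measure, forall t : R, t \in `[0, T] ->
         F1 g f1 (x t) (y t) (u t) (a t) (- derive1 x t) /\
         derive1 y t = f2 (b t) (x t)},
      x 0 = x0, Cmov g (u 0) x0
    & y 0 = 0].

Definition is_mesh (R : realType) (T : R) (k : nat) (t : nat -> R) : Prop :=
  [/\ t 0%N = 0, t k = T
    & forall j, (j < k)%N -> t j < t j.+1 /\ t j.+1 - t j <= T / k%:R].

(* On each mesh interval, z is affine with slope v j. *)
Definition linear_with_slopes (R : realType) (p k : nat) (t : nat -> R)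
    (z : R -> 'rV[R]_p) (v : nat -> 'rV[R]_p) : Prop :=
  forall j, (j < k)%N -> forall r, r \in `[t j, t j.+1] ->
    z r = z (t j) + (r - t j) *: v j.

Definition piecewise_linear (R : realType) (p k : nat) (t : nat -> R)
    (z : R -> 'rV[R]_p) : Prop :=
  exists v, linear_with_slopes k t z v.

(* Main.v *)
Require Import Defs.
From mathcomp Require Import all_boot all_order all_algebra.
From mathcomp Require Import all_classical all_reals all_analysis.
From mathcomp Require Import measurable_realfun ring lra.
Import Order.TTheory GRing.Theory Num.Theory.
Import numFieldNormedType.Exports.
Local Open Scope classical_set_scope.
Local Open Scope ring_scope.

(** The discrete trajectories are built explicitly. Write xi = xb - ub, so
    that the constraint says that xi (t) lies in C, and phi (t) = f1 (ab t,
    xb t) + yb t, so that for almost every t the vector - xb' (t) - phi (t)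
    is normal to C at xi (t). On each mesh one picks nodes tau_j inside the
    cells, at points where the inclusion holds, and so close to t_j that xi
    (tau_j) is almost xi (t_j). At the first mesh point, where the values
    are prescribed and the inclusion may fail, tau_0 = 0 and the normal
    vector 0 is used instead, which costs one cell only. The discrete arcs
    x_j, y_j are then defined by an explicit recursion in which the normal
    vector at step j is the one selected at tau_j, a and b are sampled at
    the mesh points, and the control u_j = x_j - xi (tau_j) is adjusted so
    that x_j - u_j is the point xi (tau_j) of C. Since the normal cone to a
    translate is the translated normal cone, the discrete inclusion holds
    exactly.

    It remains to compare velocities. The slope v_j of the discrete state
    differs from xb' on the j-th cell by the oscillation D_j of xb' there, a
    modulus of continuity of phi, and the errors |x_j - xb (t_j)| and |y_j -
    yb (t_j)| multiplied by Lipschitz constants. Since xb' has bounded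
    variation the sum of the D_j is bounded, hence the sum of h_j D_j and
    the sum of h_j D_j^2 are O(1/k); a discrete Gronwall inequality
    ([discrete_gronwall], [E_bound]) bounds the errors, and
    [veldist_step_cvg] turns the velocity estimate into L^2 convergence. The
    Lipschitz constants are local, so the a priori bound on x_j is proved in
    the same induction.

    The nodal interpolants of ab and bb converge in W^{1,2}, and so does the
    interpolant of the values xi (tau_j), whose slopes differ by O(1/k) from
    those of the nodal interpolant of xi. Indeed the velocities of nodal
    interpolants are the cell means of an L^2 function ([mean_vel_cvg]): the
    cell means S_k converge to f' at every differentiability point, and, by
    orthogonality, |f' - S_k|^2 and |f'|^2 - |S_k|^2 have the same integral,
    which is at most that of the positive part of |f'|^2 - |S_k|^2; the
    latter tends to 0 by dominated convergence.

    All the analysis is done coordinatewise: [W12_coord] and [W12_of_coord]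
    reduce W^{1,2} arcs to scalar ones. The point there is that the
    derivative of a continuous function, set to 0 where it does not exist,
    is Borel measurable ([measurable_derive1]). In the estimates the sup
    norm on row vectors replaces the Euclidean one. *)

Set Implicit Arguments.
Unset Strict Implicit.
Unset Printing Implicit Defensive.

(** * Measurability of derivatives *)

Section derivative_measurable.
Context {R : realType}.

(** Difference quotient of [f] at [t] with increment [h]. *)
Definition diffq (f : R -> R) (t h : R) : R := h^-1 * (f (h + t) - f t).

(** Cauchy criterion: it describes the set of differentiability points by
    countable operations from closed conditions. *)
Lemma derivable_cauchy (f : R -> R) (t : R) :
  derivable f t 1 <->
  forall m : nat, exists n : nat, forall h h' : R,
    0 < `|h| < n.+1%:R^-1 -> 0 < `|h'| < n.+1%:R^-1 ->
    `|diffq f t h - diffq f t h'| <= m.+1%:R^-1.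
Proof.
have E : (fun h => h^-1 *: (f (h *: (1:R) + t) - f t)) = diffq f t.
  by apply/funext => h; rewrite /diffq /GRing.scale/= mulr1.
rewrite /derivable E; split.
  move=> /cvg_cauchy /cauchyP H m.
  have [|l] := H (m.+1%:R^-1 / 2); first by rewrite divr_gt0// invr_gt0.
  rewrite /nbhs/= /dnbhs/within/= => /nbhs_ballP[e /= e0 He].
  have [n ne] : exists n : nat, n.+1%:R^-1 < e.
    by exists (Num.truncn e^-1); rewrite invf_plt ?posrE// truncnS_gt.
  have K h : 0 < `|h| < n.+1%:R^-1 -> `|l - diffq f t h| < m.+1%:R^-1 / 2.
    move=> /andP[h0 hn]; apply: He; last by rewrite -normr_gt0.
    by rewrite /ball/= sub0r normrN (lt_trans hn).
  exists n => h h' /K Kh /K Kh'.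
  rewrite -(subrKA l) (le_trans (ler_normD _ _))// [leRHS]splitr lerD// ltW//.
  by rewrite distrC.
move=> H; apply/cauchy_cvgP/cauchy_exP => /= e e0.
have [m me] : exists m : nat, m.+1%:R^-1 < e.
  by exists (Num.truncn e^-1); rewrite invf_plt ?posrE// truncnS_gt.
have [n Hn] := H m.
exists (diffq f t (n.+1%:R^-1 / 2)).
rewrite /nbhs/= /dnbhs/within/=; apply/nbhs_ballP; exists n.+1%:R^-1 => //=.
move=> h; rewrite /ball/= sub0r normrN => hn h0.
apply: le_lt_trans me; apply: Hn; last by rewrite normr_gt0 h0.
have : (0:R) < n.+1%:R^-1 by rewrite invr_gt0.
move=> n0; rewrite ger0_norm; last by rewrite divr_ge0// ltW.
rewrite divr_gt0//=.
by rewrite ltr_pdivrMr// mulrDr mulr1 ltrDl.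
Qed.

Lemma continuous_diffq (f : R -> R) (h : R) :
  continuous f -> continuous (fun t => diffq f t h).
Proof.
move=> cf t; rewrite /diffq; apply: cvgM; first exact: cvg_cst.
apply: cvgB; last exact: cf.
apply: continuous_comp; last exact: cf.
by apply: cvgD; [exact: cvg_cst|exact: cvg_id].
Qed.

Lemma measurable_derivable (f : R -> R) :
  continuous f -> measurable [set t | derivable f t 1].
Proof.
move=> cf.
rewrite (_ : [set t | _] = \bigcap_(m : nat) \bigcup_(n : nat)
  \bigcap_(h in [set h : R | 0 < `|h| < n.+1%:R^-1])
  \bigcap_(h' in [set h' : R | 0 < `|h'| < n.+1%:R^-1])
  [set t | `|diffq f t h - diffq f t h'| <= m.+1%:R^-1]); last first.
  apply/seteqP; split=> t /=.
    move=> /derivable_cauchy H m _; have [n Hn] := H m.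
    by exists n => // h /= hh h' hh'; exact: Hn.
  move=> H; apply/derivable_cauchy => m; have [n _ Hn] := H m I.
  by exists n => h h' hh hh'; exact: (Hn h hh h' hh').
apply: bigcap_measurable => // m _; apply: bigcup_measurable => n _.
apply: closed_measurable; apply: closed_bigI => h _; apply: closed_bigI => h' _.
have c : continuous (fun t => `|diffq f t h - diffq f t h'|).
  move=> t; apply: cvg_norm; apply: cvgB; exact: continuous_diffq.
have := @closed_comp _ _ _ [set x : R | x <= m.+1%:R^-1] (fun x _ => c x).
by apply; exact: closed_le.
Qed.

Lemma derivable_diffq_cvg (f : R -> R) (t : R) : derivable f t 1 ->
  diffq f t n.+1%:R^-1 @[n --> \oo] --> derive1 f t.
Proof.
move=> df; rewrite derive1E.
have E : (fun h => h^-1 *: (f (h *: (1:R) + t) - f t)) = diffq f t.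
  by apply/funext => h; rewrite /diffq /GRing.scale/= mulr1.
have := df; rewrite /derivable E => /cvg_ex[l dl].
rewrite /derive E (cvg_lim _ dl)//.
have c0 : n.+1%:R^-1 @[n --> \oo] --> (0:R)^'.
  move=> A /= [e /= e0 eA].
  have := @cvg_harmonic R => /cvgrPdist_lt /(_ e e0) [N _ HN].
  exists N => // n /= Nn; apply: eA; last by rewrite invr_eq0 pnatr_eq0.
  exact: HN.
exact: cvg_comp c0 dl.
Qed.

(** No differentiability is assumed: at the other points [derive1 f] has
    the default value 0. *)
Lemma measurable_derive1 (f : R -> R) :
  continuous f -> measurable_fun setT (derive1 f).
Proof.
move=> cf; pose E := [set t | derivable f t 1].
have mE : measurable E by exact: measurable_derivable.
have H n : measurable_fun setT (diffq f ^~ n.+1%:R^-1 \_ E).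
  apply/(measurable_restrictT _ mE); apply: (measurable_funS measurableT) => //.
  by apply: continuous_measurable_fun; exact: continuous_diffq.
apply: (measurable_fun_cvg H) => t _.
rewrite /patch; have [tE|tE] := boolP (t \in E); last first.
  have -> : derive1 f t = 0.
    rewrite derive1E /derive dvgP//.
    by move=> c; move: tE; rewrite notin_setE; apply; exact: c.
  exact: cvg_cst.
rewrite inE/= in tE; exact: derivable_diffq_cvg.
Qed.

(** As soon as one coordinate is not derivable at [t] the whole vector
    [derive1 z t] has the default value 0, so this does not follow from
    the scalar case alone. *)
Lemma measurable_derive1_mx p (z : R -> 'rV[R]_p) (i : 'I_p) :
  continuous z -> measurable_fun setT (fun t => derive1 z t 0 i).
Proof.
move=> cz.
have ci j : continuous (fun t => z t 0 j).
  move=> t; apply: (@continuous_comp _ _ _ z (fun M : 'rV[R]_p => M 0 j)).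
    exact: cz.
  exact: coord_continuous.
pose E := [set t | derivable z t 1].
have EE : E = \bigcap_(j in [set: 'I_p]) [set t | derivable (fun t => z t 0 j) t 1].
  apply/seteqP; split=> t.
    by move=> /= /derivable_mxP H j _; exact: H.
  move=> H; apply/derivable_mxP => i' j.
  by rewrite (ord1 i'); exact: (H j I).
have mE : measurable E.
  rewrite EE; apply: fin_bigcap_measurable => [|j _]; first exact: finite_finset.
  exact: measurable_derivable.
have -> : (fun t => derive1 z t 0 i) = (derive1 (fun t => z t 0 i)) \_ E.
  apply/funext => t; rewrite /patch; have [tE|tE] := boolP (t \in E); last first.
    rewrite derive1E /derive dvgP ?mxE//.
    by move=> c; move: tE; rewrite notin_setE; apply; exact: c.
  by rewrite inE/= in tE; rewrite derive1E derive_mx// mxE -derive1E.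
apply/(measurable_restrictT _ mE); apply: (measurable_funS measurableT) => //.
exact: measurable_derive1.
Qed.

End derivative_measurable.

(** * Almost everywhere statements *)

Section almost_everywhere.
Context {R : realType}.
Notation mu := (@lebesgue_measure R).

Lemma ae_mono (P Q : R -> Prop) : (forall t, P t -> Q t) ->
  {ae mu, forall t : R, P t} -> {ae mu, forall t : R, Q t}.
Proof. by move=> PQ; apply: (@filterS _ _ (ae_filter_ringOfSetsType mu)). Qed.

Lemma ae_and (P Q : R -> Prop) : {ae mu, forall t : R, P t} ->
  {ae mu, forall t : R, Q t} -> {ae mu, forall t : R, P t /\ Q t}.
Proof. exact: (@filterI _ _ (ae_filter_ringOfSetsType mu)). Qed.

Lemma ae_forall (I : finType) (P : I -> R -> Prop) :
  (forall i, {ae mu, forall t : R, P i t}) ->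
  {ae mu, forall t : R, forall i, P i t}.
Proof.
move=> H; have : {ae mu, forall t : R, forall i, i \in enum I -> P i t}.
  elim: (enum I) => [|i s]; first by apply: aeW.
  move=> /(ae_and (H i)); apply: ae_mono => t [Pi Ps] j.
  by rewrite in_cons => /predU1P[->//|]; exact: Ps.
by apply: ae_mono => t Ht i; apply: Ht; rewrite mem_enum.
Qed.

End almost_everywhere.

(** * Scalar arcs with square integrable velocity *)

Section scalar_W12.
Context {R : realType}.
Notation mu := (@lebesgue_measure R).

(** Scalar counterpart of [W12]. *)
Definition sW12 (T : R) (f : R -> R) : Prop :=
  [/\ {ae mu, forall t : R, t \in `[0, T] -> derivable f t 1},
      measurable_fun `[0, T] (derive1 f),
      (\int[mu]_(t in `[0%R, T]) ((derive1 f t) ^+ 2)%:E < +oo)%E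
    & forall t, t \in `[0, T] ->
        f t = f 0 + \int[mu]_(r in `[0, t]) (derive1 f r)].

(** Projection onto [0, T]. Arcs are only controlled on [0, T]; composing
    with [clamp T] extends them continuously to the line. *)
Definition clamp (T t : R) : R := Num.max 0 (Num.min t T).

Lemma clamp_in (T t : R) : 0 <= T -> clamp T t \in `[0, T].
Proof.
by move=> T0; rewrite in_itv/= /clamp le_max lexx/= ge_max T0 ge_min lexx orbT.
Qed.

Lemma clamp_id (T t : R) : t \in `[0, T] -> clamp T t = t.
Proof.
rewrite in_itv/= => /andP[t0 tT]; rewrite /clamp.
by rewrite (min_idPl tT); apply/max_idPr.
Qed.

Lemma continuous_clamp (T : R) : continuous (clamp T).
Proof.
move=> t; have := @continuous_max R _ (cst 0) (fun t => Num.min t T) t.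
apply; first exact: cvg_cst.
by apply: (@continuous_min R _ id (cst T)); [exact: cvg_id|exact: cvg_cst].
Qed.

Lemma clamp_continuous (U : topologicalType) (T : R) (f : R -> U) : 0 <= T ->
  {within `[0, T], continuous f} -> continuous (f \o clamp T).
Proof.
move=> T0 cf t.
have := cf (clamp T t); rewrite /continuous_at.
rewrite /nbhs/= -nbhs_subspace_in; last exact: clamp_in.
move=> H; apply: cvg_comp H.
move=> A; rewrite /within/= => HA.
have H2 := @continuous_clamp T t _ HA.
apply: (@filterS _ (nbhs (t : R)) _
  (fun s : R => clamp T s \in `[0, T] -> A (clamp T s))) H2.
by move=> s; apply; exact: clamp_in.
Qed.

Lemma measurable_itv0_clamp (T : R) (f g : R -> R) : {in `]0, T[, f =1 g} ->
  measurable_fun setT g -> measurable_fun `[0, T] f.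
Proof.
move=> fg mg; have [T0|T0] := ltP 0 T.
  apply/measurable_fun_itv_bndo_bndcP/measurable_fun_itv_obnd_cbndP.
  apply: (eq_measurable_fun g); first by move=> x; rewrite inE/= => /fg.
  exact: measurable_funS mg.
have [->|Tn] := eqVneq T 0; first by rewrite set_itv1; exact: measurable_fun_set1.
rewrite set_itv_ge; first exact: measurable_fun_set0.
by rewrite bnd_simp -ltNge lt_neqAle Tn.
Qed.

Lemma near_clamp (U : Type) (T t : R) (f : R -> U) : t \in `]0, T[ ->
  \forall s \near t, (f \o clamp T) s = f s.
Proof.
move=> tT; have := near_in_itvoo tT; apply: filterS => s; rewrite inE/= => sT.
rewrite clamp_id//; move: sT; rewrite !in_itv/= => /andP[a b].
by rewrite !ltW.
Qed.

Lemma measurable_derive1_clamp (T : R) (f : R -> R) :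
  continuous (f \o clamp T) -> measurable_fun `[0, T] (derive1 f).
Proof.
move=> /measurable_derive1; apply: measurable_itv0_clamp => t tT.
by rewrite !derive1E; apply/esym/near_eq_derive; exact: near_clamp.
Qed.

Lemma measurable_derive1_mx_clamp (T : R) p (z : R -> 'rV[R]_p) (i : 'I_p) :
  continuous (z \o clamp T) ->
  measurable_fun `[0, T] (fun t => derive1 z t 0 i).
Proof.
move=> /(measurable_derive1_mx i); apply: measurable_itv0_clamp => t tT.
rewrite !derive1E; congr (_ _ 0 i).
by apply/esym/near_eq_derive; exact: near_clamp.
Qed.

Lemma sq_integrable (T : R) (f : R -> R) : measurable_fun `[0, T] f ->
  (\int[mu]_(t in `[0%R, T]) ((f t) ^+ 2)%:E < +oo)%E ->
  mu.-integrable `[0, T] (EFin \o (fun t => f t ^+ 2)).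
Proof.
move=> mf foo; apply/integrableP; split.
  by apply/measurable_EFinP; apply: measurable_funX; exact: mf.
by under eq_integral do rewrite /= ger0_norm ?sqr_ge0//.
Qed.

Lemma integrable_cst_itv (a b c : R) : mu.-integrable `[a, b] (EFin \o cst c).
Proof.
apply/integrableP; split; first exact/measurable_EFinP.
under eq_integral do rewrite /=.
rewrite (@integral_cst _ _ _ mu)//= lebesgue_measure_itv/=.
by case: ifP => _; rewrite ?mule0// -EFinB -EFinM ltry.
Qed.

Lemma sq_integrable1 (T : R) (f : R -> R) : measurable_fun `[0, T] f ->
  (\int[mu]_(t in `[0%R, T]) ((f t) ^+ 2)%:E < +oo)%E ->
  mu.-integrable `[0, T] (EFin \o f).
Proof.
move=> mf /(sq_integrable mf) sf.
have i1 : mu.-integrable `[0, T] (EFin \o (fun t => 1 + f t ^+ 2)).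
  apply: (@integrableD _ _ R mu _ _ (EFin \o cst 1)
    (EFin \o (fun t => f t ^+ 2))) => //.
  exact: integrable_cst_itv.
apply: (le_integrable _ _ _ i1) => //; first exact/measurable_EFinP.
move=> t _ /=; rewrite lee_fin [leRHS]ger0_norm ?addr_ge0 ?sqr_ge0//.
have := sqr_ge0 (`|f t| - 1); rewrite sqrrB expr1n mulr1 real_normK ?num_real//.
have := sqr_ge0 (f t); have := normr_ge0 (f t); lra.
Qed.

Lemma rep_continuous (T : R) (f h : R -> R) : 0 <= T ->
  mu.-integrable `[0, T] (EFin \o h) ->
  (forall t, t \in `[0, T] -> f t = f 0 + \int[mu]_(r in `[0, t]) h r) ->
  continuous (f \o clamp T).
Proof.
move=> T0 ih fh.
have -> : f \o clamp T =
    (fun t => f 0 + \int[mu]_(r in `[0, t]) h r) \o clamp T.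
  by apply/funext => t /=; apply: fh; exact: clamp_in.
have H := clamp_continuous T0 (parameterized_integral_continuous T0 ih).
move=> t; apply: cvgD; first exact: cvg_cst.
exact: H.
Qed.

Lemma sW12_integrable (T : R) (f : R -> R) : sW12 T f ->
  mu.-integrable `[0, T] (EFin \o derive1 f).
Proof. by case=> _ mf foo _; exact: sq_integrable1. Qed.

Lemma sW12_continuous (T : R) (f : R -> R) : 0 <= T -> sW12 T f ->
  continuous (f \o clamp T).
Proof.
move=> T0 Wf; apply: rep_continuous (sW12_integrable Wf) _ => //.
by case: Wf.
Qed.

Lemma rV_continuous (U : topologicalType) p (z : U -> 'rV[R]_p) :
  (forall i, continuous (fun t => z t 0 i)) -> continuous z.
Proof.
move=> cz t; apply/cvgrPdist_lt => e e0.
have H : \forall s \near t, forall i : 'I_p, `|z t 0 i - z s 0 i| < e.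
  by apply: filter_forall => i; move/cvgrPdist_lt : (cz i t) => /(_ _ e0).
apply: filterS H => s H; rewrite [ltLHS]/Num.Def.normr/= mx_normrE.
by apply/bigmax_ltP; split => // -[i j] _; rewrite (ord1 i)/= !mxE.
Qed.

Lemma enorm_sqr p (v : 'rV[R]_p) : enorm v ^+ 2 = \sum_(i < p) v 0 i ^+ 2.
Proof. by rewrite /enorm sqr_sqrtr// sumr_ge0// => i _; exact: sqr_ge0. Qed.

Lemma coord_sqr_le_enorm p (v : 'rV[R]_p) i : v 0 i ^+ 2 <= enorm v ^+ 2.
Proof.
rewrite enorm_sqr (bigD1 i)//= lerDl sumr_ge0// => j _; exact: sqr_ge0.
Qed.

Lemma ae_Rintegral (T t : R) (f g : R -> R) : t \in `[0, T] ->
  measurable_fun `[0, T] f -> measurable_fun `[0, T] g ->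
  {ae mu, forall r : R, r \in `[0, T] -> f r = g r} ->
  \int[mu]_(r in `[0, t]) f r = \int[mu]_(r in `[0, t]) g r.
Proof.
rewrite in_itv/= => /andP[t0 tT] mf mg fg; congr fine.
have s : `[0, t] `<=` `[0, T].
  by apply: subset_itvl; rewrite bnd_simp.
apply: ae_eq_integral => //.
- by apply/measurable_EFinP; exact: measurable_funS mf.
- by apply/measurable_EFinP; exact: measurable_funS mg.
- by apply: ae_mono fg => r h /s /h ->.
Qed.

Lemma ae_integral (T : R) (f g : R -> R) :
  measurable_fun `[0, T] f -> measurable_fun `[0, T] g ->
  {ae mu, forall r : R, r \in `[0, T] -> f r = g r} ->
  (\int[mu]_(r in `[0%R, T]) (f r)%:E = \int[mu]_(r in `[0%R, T]) (g r)%:E)%E.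
Proof.
move=> mf mg fg; apply: ae_eq_integral => //.
- exact/measurable_EFinP.
- exact/measurable_EFinP.
- by apply: ae_mono fg => r h /h ->.
Qed.

(** A vector arc and its coordinates have the same velocities only almost
    everywhere, so the measurability of the velocity has to be proved
    anew. *)
Lemma W12_coord (T : R) p (z : R -> 'rV[R]_p) (i : 'I_p) : 0 <= T ->
  W12 T z -> sW12 T (fun t => z t 0 i).
Proof.
move=> T0 [dz mz ioo rep].
have ioo' : (\int[mu]_(t in `[0%R, T]) ((derive1 z t 0 i) ^+ 2)%:E < +oo)%E.
  apply: le_lt_trans ioo; apply: ge0_le_integral => //.
  - by move=> t _; rewrite lee_fin sqr_ge0.
  - by apply/measurable_EFinP; apply: measurable_funX; exact: mz.
  - apply/measurable_EFinP.
    apply: (eq_measurable_fun (fun t => \sum_(j < p) derive1 z t 0 j ^+ 2)).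
      by move=> t _; rewrite enorm_sqr.
    by apply: measurable_sum => j; apply: measurable_funX; exact: mz.
  - by move=> t _; rewrite lee_fin coord_sqr_le_enorm.
have cz := rep_continuous T0 (sq_integrable1 (mz i) ioo') (fun t tT => rep t tT i).
have mzi : measurable_fun `[0, T] (derive1 (fun t => z t 0 i)).
  exact: measurable_derive1_clamp.
have ae : {ae mu, forall t : R, t \in `[0, T] ->
    derive1 (fun t => z t 0 i) t = derive1 z t 0 i}.
  by apply: ae_mono dz => t /[apply] dz; rewrite !derive1E derive_mx// mxE.
split => //.
- by apply: ae_mono dz => t /[apply] /derivable_mxP; exact.
- rewrite (@ae_integral _ _ (fun t => (derive1 z t 0 i) ^+ 2))//.
  + by apply: measurable_funX; exact: mzi.
  + by apply: measurable_funX; exact: mz.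
  + by apply: ae_mono ae => t /[apply] ->.
- by move=> t tT; rewrite rep//; congr (_ + _); apply/esym/(ae_Rintegral tT).
Qed.

Lemma W12_of_coord (T : R) p (z : R -> 'rV[R]_p) : 0 <= T ->
  (forall i, sW12 T (fun t => z t 0 i)) -> W12 T z.
Proof.
move=> T0 W.
have dz : {ae mu, forall t : R, t \in `[0, T] -> derivable z t 1}.
  have : {ae mu, forall t : R, forall i, t \in `[0, T] ->
      derivable (fun t => z t 0 i) t 1}.
    by apply: ae_forall => i; case: (W i).
  apply: ae_mono => t H tT; apply/derivable_mxP => i j; rewrite (ord1 i).
  exact: H.
have mz i : measurable_fun `[0, T] (fun t => derive1 z t 0 i).
  apply: measurable_derive1_mx_clamp; apply: rV_continuous => j.
  exact: sW12_continuous (W j).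
have ae : {ae mu, forall t : R, t \in `[0, T] -> forall i,
    derive1 z t 0 i = derive1 (fun t => z t 0 i) t}.
  by apply: ae_mono dz => t /[apply] dz i; rewrite !derive1E derive_mx// mxE.
split => //.
- under eq_integral do rewrite enorm_sqr -sumEFin.
  rewrite ge0_integral_sum//; last 2 first.
  + by move=> i; apply/measurable_EFinP; apply: measurable_funX; exact: mz.
  + by move=> i t _; rewrite lee_fin sqr_ge0.
  apply: lte_sum_pinfty => i _.
  have [_ mi ioo _] := W i.
  rewrite (@ae_integral _ _ (fun t => (derive1 (fun t => z t 0 i) t) ^+ 2))//.
  + by apply: measurable_funX; exact: mz.
  + by apply: measurable_funX; exact: mi.
  + by apply: ae_mono ae => t /[apply] ->.
- move=> t tT i; have [_ mi _ ->//] := W i.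
  congr (_ + _); apply/esym/(ae_Rintegral tT) => //.
  by apply: ae_mono ae => r /[apply].
Qed.

End scalar_W12.

(** * Operations on scalar arcs *)

Section scalar_W12_theory.
Context {R : realType}.
Notation mu := (@lebesgue_measure R).

(** It is enough to exhibit a square integrable density that is the
    derivative almost everywhere. *)
Lemma sW12_intro (T : R) (f h : R -> R) : 0 <= T ->
  measurable_fun `[0, T] h ->
  (\int[mu]_(t in `[0%R, T]) ((h t) ^+ 2)%:E < +oo)%E ->
  (forall t, t \in `[0, T] -> f t = f 0 + \int[mu]_(r in `[0, t]) h r) ->
  {ae mu, forall t : R, t \in `[0, T] -> is_derive t (1:R) f (h t)} ->
  sW12 T f.
Proof.
move=> T0 mh hoo rep df.
have cf := rep_continuous T0 (sq_integrable1 mh hoo) rep.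
have mf := measurable_derive1_clamp cf.
have ae : {ae mu, forall t : R, t \in `[0, T] -> derive1 f t = h t}.
  by apply: ae_mono df => t /[apply] -[_ <-]; rewrite derive1E.
split => //.
- by apply: ae_mono df => t /[apply] -[].
- rewrite (@ae_integral _ _ _ (fun t => h t ^+ 2))//.
  + exact: measurable_funX.
  + exact: measurable_funX.
  + by apply: ae_mono ae => t /[apply] ->.
- by move=> t tT; rewrite rep//; congr (_ + _); apply/esym/(ae_Rintegral tT).
Qed.

Lemma sW12_is_derive (T : R) (f : R -> R) : sW12 T f ->
  {ae mu, forall t : R, t \in `[0, T] -> is_derive t (1:R) f (derive1 f t)}.
Proof.
by case=> df _ _ _; apply: ae_mono df => t /[apply] df; split; rewrite ?derive1E.
Qed.

Lemma integrable_prefix (T t : R) (f : R -> R) : t \in `[0, T] ->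
  mu.-integrable `[0, T] (EFin \o f) -> mu.-integrable `[0, t] (EFin \o f).
Proof.
rewrite in_itv/= => /andP[t0 tT]; apply: integrableS => //.
by apply: subset_itvl; rewrite bnd_simp.
Qed.

Lemma sqr_lin_le (a x y : R) :
  (a * x + y) ^+ 2 <= (2 * a ^+ 2) * x ^+ 2 + 2 * y ^+ 2.
Proof. have := sqr_ge0 (a * x - y); nra. Qed.

Lemma sW12_lin (T a : R) (f g : R -> R) : 0 <= T -> sW12 T f -> sW12 T g ->
  sW12 T (fun t => a * f t + g t).
Proof.
move=> T0 Wf Wg; have [_ mf foo rf] := Wf; have [_ mg goo rg] := Wg.
have m : measurable_fun `[0, T] (fun t => a * derive1 f t + derive1 g t).
  by apply: measurable_funD => //; apply: measurable_funM.
apply: (@sW12_intro _ _ (fun t => a * derive1 f t + derive1 g t)) => //.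
- have ifg : mu.-integrable `[0, T]
      (EFin \o (fun t => (2 * a ^+ 2) * derive1 f t ^+ 2 + 2 * derive1 g t ^+ 2)).
    apply: (@integrableD _ _ R mu _ _
      (EFin \o (fun t => (2 * a ^+ 2) * derive1 f t ^+ 2))
      (EFin \o (fun t => 2 * derive1 g t ^+ 2))) => //.
      exact: (integrableZl _ _ (sq_integrable mf foo)).
    exact: (integrableZl _ _ (sq_integrable mg goo)).
  case/integrableP : ifg => _; apply: le_lt_trans; apply: ge0_le_integral => //.
  + by move=> t _; rewrite lee_fin sqr_ge0.
  + by apply/measurable_EFinP; exact: measurable_funX.
  + apply/measurableT_comp => //; apply/measurable_EFinP.
    by apply: measurable_funD; apply: measurable_funM => //; exact: measurable_funX.
  + by move=> t _ /=; rewrite lee_fin (le_trans (sqr_lin_le _ _ _))// ler_norm.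
- move=> t tT; rewrite rf// rg// RintegralD//=; last 2 first.
  + exact: (integrableZl _ _ (integrable_prefix tT (sW12_integrable Wf))).
  + exact: integrable_prefix tT (sW12_integrable Wg).
  rewrite RintegralZl//; first by ring.
  exact: integrable_prefix tT (sW12_integrable Wf).
- have := ae_and (sW12_is_derive Wf) (sW12_is_derive Wg).
  apply: ae_mono => t [Hf Hg] tT; have {}Hf := Hf tT; have {}Hg := Hg tT.
  have H : is_derive t (1:R) (a \*: f + g) (a *: derive1 f t + derive1 g t).
    by apply: is_deriveD; apply: is_deriveZ.
  exact: H.
Qed.

Lemma sW12_cst (T a : R) : 0 <= T -> sW12 T (cst a).
Proof.
move=> T0; apply: (@sW12_intro _ _ (cst 0)) => //.
- under eq_integral do rewrite /= expr0n/=.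
  by rewrite integral0.
- by move=> t _; rewrite Rintegral_cst// mul0r addr0.
- by apply: aeW => t _; exact: is_derive_cst.
Qed.

Lemma sW12_sub (T : R) (f g : R -> R) : 0 <= T -> sW12 T f -> sW12 T g ->
  sW12 T (fun t => f t - g t).
Proof.
move=> T0 Wf Wg; have := sW12_lin (-1) T0 Wg Wf.
by congr sW12; apply/funext => t; rewrite mulN1r addrC.
Qed.

Lemma sW12_scale (T a : R) (f : R -> R) : 0 <= T -> sW12 T f ->
  sW12 T (fun t => a * f t).
Proof.
move=> T0 Wf; have := sW12_lin a T0 Wf (sW12_cst 0 T0).
by congr sW12; apply/funext => t; rewrite addr0.
Qed.

Lemma sW12_sum (T : R) (I : Type) (s : seq I) (f : I -> R -> R) : 0 <= T ->
  (forall i, sW12 T (f i)) -> sW12 T (fun t => \sum_(i <- s) f i t).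
Proof.
move=> T0 W; elim: s => [|i s IH].
  have := sW12_cst 0 T0; congr sW12; apply/funext => t /=.
  by rewrite big_nil.
have := sW12_lin 1 T0 (W i) IH; congr sW12; apply/funext => t.
by rewrite big_cons mul1r.
Qed.

Lemma ae_neq (a : R) : {ae mu, forall t : R, t != a}.
Proof.
exists [set a]; split => //; first by rewrite lebesgue_measure_set1.
by move=> t /= /negP; rewrite negbK => /eqP.
Qed.

(** Ramps are the building blocks of piecewise linear functions. *)
Lemma sW12_ramp (T a : R) : 0 <= a <= T -> sW12 T (fun r => Num.min r a).
Proof.
move=> /andP[a0 aT]; have T0 := le_trans a0 aT.
pose h := \1_`]-oo, a[ : R -> R.
have hE r : h r = (r < a)%R%:R by rewrite /h indicE/= mem_setE in_itv.
have h2 r : h r ^+ 2 <= 1 by rewrite hE; case: ltP => _; rewrite ?expr1n ?expr0n.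
have mh : measurable_fun `[0, T] h by apply: measurable_indic.
apply: (@sW12_intro _ _ h) => //.
- apply: (@le_lt_trans _ _ (\int[mu]_(t in `[0%R, T]) (cst 1%E t))%E).
    apply: ge0_le_integral => //.
    + by move=> t _; rewrite lee_fin sqr_ge0.
    + by apply/measurable_EFinP; exact: measurable_funX.
    + by move=> t _; rewrite lee_fin.
  rewrite (@integral_cst _ _ _ mu)//= lebesgue_measure_itv/= mul1e.
  by case: ifP => _ //; rewrite -EFinB ltry.
- move=> t; rewrite in_itv/= => /andP[t0 tT].
  rewrite (min_idPl a0) add0r /Rintegral.
  under eq_integral do rewrite /h.
  rewrite (@integral_indic _ _ _ mu)//.
  have [ta|at_] := ltP t a.
    rewrite (_ : `]-oo, a[ `&` `[0, t] = `[0, t]%classic).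
      rewrite /= lebesgue_measure_itv/= lte_fin.
      by move: t0; rewrite le_eqVlt => /predU1P[<-|->]; rewrite ?ltxx//= subr0.
    apply/seteqP; split => x /=; first by case.
    by rewrite !in_itv/= => /andP[x0 xt]; rewrite x0 xt (le_lt_trans xt).
  rewrite (_ : `]-oo, a[ `&` `[0, t] = `[0, a[%classic).
    rewrite /= lebesgue_measure_itv/= lte_fin.
    by move: a0; rewrite le_eqVlt => /predU1P[<-|->]; rewrite ?ltxx//= subr0.
  apply/seteqP; split => x /=; rewrite !in_itv/=.
    by move=> [-> /andP[->]].
  by move=> /andP[x0 xa]; rewrite x0 xa (le_trans (ltW xa)).
- have := ae_neq a; apply: ae_mono => t ta _.
  rewrite hE; case: ltgtP ta => // ta _.
    have -> : true%:R = 1 :> R by [].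
    apply: near_eq_is_derive (is_derive_id t (1:R)).
    have := lt_nbhsl ta; apply: filterS => x xa.
    by apply/esym/min_idPl/ltW.
  have -> : false%:R = 0 :> R by [].
  apply: near_eq_is_derive (is_derive_cst a t (1:R)).
  have := lt_nbhsr ta; apply: filterS => x xa.
  by apply/esym/min_idPr/ltW.
Qed.

(** Cauchy-Schwarz: the velocity controls the arc uniformly. *)
Lemma sW12_sup (T : R) (f : R -> R) t : 0 < T -> sW12 T f -> f 0 = 0 ->
  t \in `[0, T] ->
  (f t) ^+ 2 <= T * \int[mu]_(r in `[0, T]) (derive1 f r ^+ 2).
Proof.
move=> T0 Wf f0 tT; have [_ mf foo rf] := Wf.
have iF := sW12_integrable Wf; have i2 := sq_integrable mf foo.
have iN : mu.-integrable `[0, T] (EFin \o (fun r => `|derive1 f r|)).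
  exact: integrable_norm.
set P := \int[mu]_(r in `[0, T]) `|derive1 f r|.
set Q := Rintegral _ _ _.
have fP : `|f t| <= P.
  rewrite rf// f0 add0r.
  apply: le_trans (le_normr_Rintegral _ _) _ => //.
    exact: integrable_prefix tT iF.
  rewrite /P; have tT' := tT; rewrite in_itv/= in tT'; case/andP: tT' => t0 tT'.
  rewrite fine_le//.
  + by have := integrable_fin_num _ (integrable_prefix tT iN); exact.
  + by have := integrable_fin_num _ iN; exact.
  apply: ge0_subset_integral => //.
  + by apply/measurableT_comp => //; apply/measurableT_comp.
  + by apply: subset_itvl; rewrite bnd_simp.
have PQ l : 0 <= Q - 2 * l * P + l ^+ 2 * T.
  have : 0 <= \int[mu]_(r in `[0, T]) (`|derive1 f r| - l) ^+ 2.
    by apply: Rintegral_ge0 => r _; exact: sqr_ge0.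
  have ic c : mu.-integrable `[0, T] (EFin \o cst c).
    exact: integrable_cst_itv.
  rewrite (@eq_Rintegral _ _ _ mu _
    (fun r => derive1 f r ^+ 2 + ((- (2 * l)) * `|derive1 f r| + l ^+ 2)));
    last first.
    by move=> r _; rewrite sqrrB real_normK ?num_real//; ring.
  have i3 : mu.-integrable `[0, T] (EFin \o (fun r => - (2 * l) * `|derive1 f r|)).
    exact: (integrableZl _ _ iN).
  rewrite RintegralD//; last by exact: (integrableD _ i3 (ic (l ^+ 2))).
  rewrite RintegralD//; last exact: ic.
  rewrite RintegralZl// (@Rintegral_cst _ _ _ mu)//= lebesgue_measure_itv/=.
  rewrite lte_fin T0/= subr0.
  by rewrite -/P -/Q; congr (0 <= _); ring.
have P0 : 0 <= P by exact: Rintegral_ge0.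
apply: (@le_trans _ _ (P ^+ 2)).
  by rewrite -[f t ^+ 2]real_normK ?num_real// lerXn2r// ?nnegrE.
(* the quadratic polynomial of PQ is minimal at l = P / T *)
have := PQ (P / T).
have -> : Q - 2 * (P / T) * P + (P / T) ^+ 2 * T = Q - P ^+ 2 / T.
  by field; rewrite gt_eqF.
by rewrite subr_ge0 ler_pdivrMr// mulrC.
Qed.

End scalar_W12_theory.

(** * The L2 distance between velocities *)

Section velocity_distance.
Context {R : realType}.
Notation mu := (@lebesgue_measure R).

(** Squared L2 distance on [0, T] between the velocities of [f] and [g]. *)
Definition veldist (T : R) (f g : R -> R) : R :=
  \int[mu]_(t in `[0, T]) (derive1 f t - derive1 g t) ^+ 2.

Lemma integrable_scale (T a : R) (f : R -> R) :
  mu.-integrable `[0, T] (EFin \o f) ->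
  mu.-integrable `[0, T] (EFin \o (fun t => a * f t)).
Proof. by move=> H; exact: (integrableZl _ _ H). Qed.

Lemma derive1_sub_ae (T : R) (f g : R -> R) : sW12 T f -> sW12 T g ->
  {ae mu, forall t : R, t \in `[0, T] ->
    derive1 (fun t => f t - g t) t = derive1 f t - derive1 g t}.
Proof.
move=> /sW12_is_derive Wf /sW12_is_derive Wg.
apply: ae_mono (ae_and Wf Wg) => t [Hf Hg] tT.
have {}Hf := Hf tT; have {}Hg := Hg tT.
have [_ <-] : is_derive t (1:R) (f - g) (derive1 f t - derive1 g t).
  exact: is_deriveB.
by rewrite derive1E.
Qed.

Lemma sW12_sq_integrable (T : R) (f : R -> R) : sW12 T f ->
  mu.-integrable `[0, T] (EFin \o (fun t => derive1 f t ^+ 2)).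
Proof. by case=> _ mf foo _; exact: sq_integrable. Qed.

Lemma veldistE (T : R) (f g : R -> R) : 0 <= T -> sW12 T f -> sW12 T g ->
  \int[mu]_(t in `[0, T]) (derive1 (fun t => f t - g t) t) ^+ 2 = veldist T f g.
Proof.
move=> T0 Wf Wg; congr fine; apply: ae_integral.
- by apply: measurable_funX; case: (sW12_sub T0 Wf Wg).
- by apply/measurable_funX/measurable_funB; [case: Wf|case: Wg].
- by apply: ae_mono (derive1_sub_ae Wf Wg) => t /[apply] ->.
Qed.

Lemma veldist_integrable (T : R) (f g : R -> R) : 0 <= T -> sW12 T f -> sW12 T g ->
  mu.-integrable `[0, T] (EFin \o (fun t => (derive1 f t - derive1 g t) ^+ 2)).
Proof.
move=> T0 Wf Wg; have Wfg := sW12_sub T0 Wf Wg.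
have [_ mfg foo _] := Wfg.
have m : measurable_fun `[0, T] (fun t => derive1 f t - derive1 g t).
  by apply: measurable_funB; [case: Wf|case: Wg].
apply: sq_integrable => //.
rewrite -(@ae_integral _ _ (fun t => (derive1 (fun t => f t - g t) t) ^+ 2))//.
- exact: measurable_funX.
- exact: measurable_funX.
- by apply: ae_mono (derive1_sub_ae Wf Wg) => t /[apply] ->.
Qed.

Lemma veldist_ge0 (T : R) (f g : R -> R) : 0 <= veldist T f g.
Proof. by apply: Rintegral_ge0 => t _; exact: sqr_ge0. Qed.

Lemma sW12_measurable (T : R) (f : R -> R) : 0 <= T -> sW12 T f ->
  measurable_fun `[0, T] f.
Proof.
move=> T0 /(sW12_continuous T0)/continuous_measurable_fun mf.
apply: measurable_itv0_clamp mf => t; rewrite in_itv/= => /andP[t0 tT].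
by rewrite /= clamp_id// in_itv/= !ltW.
Qed.

(** For arcs that vanish at 0 the velocities alone control the W12 norm. *)
Lemma W12norm_cvg0 (T : R) p (w : nat -> R -> 'rV[R]_p) : 0 < T ->
  (forall k, (0 < k)%N -> W12 T (w k)) -> (forall k, (0 < k)%N -> w k 0 = 0) ->
  (forall i, \int[mu]_(t in `[0, T]) (derive1 (fun t => w k t 0 i) t) ^+ 2
     @[k --> \oo] --> 0) ->
  W12norm T (w k) @[k --> \oo] --> 0%E.
Proof.
move=> T0 Ww w0 Q0; have T0' := ltW T0.
pose Q k i := \int[mu]_(t in `[0, T]) (derive1 (fun t => w k t 0 i) t) ^+ 2.
pose r k := (T ^+ 2 + 1) * \sum_(i < p) Q k i.
have Q_ge0 k i : 0 <= Q k i by apply: Rintegral_ge0 => t _; exact: sqr_ge0.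
have r0 : r k @[k --> \oo] --> 0.
  rewrite -(mulr0 (T ^+ 2 + 1)); apply: cvgM; first exact: cvg_cst.
  rewrite [X in _ --> X](_ : 0 = \sum_(i < p) (0 : R)); last by rewrite big1.
  apply: (@cvg_big _ _ _ _ xpredT _ _ _ (index_enum 'I_p) (fun i k => Q k i)).
    exact: add_continuous.
  by move=> i _; exact: Q0.
have s0 : (Num.sqrt (r k))%:E @[k --> \oo] --> (0:R)%:E.
  apply: cvg_EFin; first by apply: nearW.
  rewrite -sqrtr0; apply: (@cvg_comp _ _ _ r Num.sqrt) r0 _.
  exact: sqrt_continuous.
apply: (@squeeze_cvge _ _ _ _ (cst 0%E) _ (fun k => (Num.sqrt (r k))%:E)) => //.
  near=> k; rewrite poweR_ge0/=.
  have k0 : (0 < k)%N by near: k; exists 1%N.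
  have Wk := Ww _ k0; have sW i := W12_coord i T0' Wk.
  have QE i : (\int[mu]_(t in `[0%R, T])
      ((derive1 (fun t => w k t 0 i) t) ^+ 2)%:E = (Q k i)%:E)%E.
    rewrite /Q /Rintegral fineK//; apply: integrable_fin_num => //.
    exact: sW12_sq_integrable.
  have A : (\int[mu]_(t in `[0%R, T]) ((enorm (w k t)) ^+ 2)%:E <=
      (T ^+ 2 * \sum_(i < p) Q k i)%:E)%E.
    apply: (@le_trans _ _ (\int[mu]_(t in `[0%R, T])
      (cst ((T * \sum_(i < p) Q k i)%:E) t))%E).
      apply: ge0_le_integral => //.
      - by move=> t _; rewrite lee_fin sqr_ge0.
      - apply/measurable_EFinP.
        apply: (eq_measurable_fun (fun t => \sum_(j < p) w k t 0 j ^+ 2)).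
          by move=> t _; rewrite enorm_sqr.
        apply: measurable_sum => j; apply: measurable_funX.
        exact: sW12_measurable (sW j).
      - move=> t tT; rewrite lee_fin enorm_sqr mulr_sumr ler_sum// => i _.
        by apply: (@sW12_sup _ _ (fun t => w k t 0 i)) => //; rewrite w0// mxE.
    rewrite (@integral_cst _ _ _ mu)//= lebesgue_measure_itv/= lte_fin T0.
    by rewrite -EFinB subr0 -EFinM lee_fin expr2 mulrAC.
  have B : (\int[mu]_(t in `[0%R, T]) ((enorm (derive1 (w k) t)) ^+ 2)%:E =
      (\sum_(i < p) Q k i)%:E)%E.
    have [dz mz _ _] := Wk.
    under eq_integral do rewrite enorm_sqr -sumEFin.
    rewrite ge0_integral_sum//; last 2 first.
    - by move=> i; apply/measurable_EFinP; apply: measurable_funX; exact: mz.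
    - by move=> i t _; rewrite lee_fin sqr_ge0.
    rewrite -sumEFin; apply: eq_bigr => i _; rewrite -QE.
    apply: (@ae_integral _ _ (fun t => derive1 (w k) t 0 i ^+ 2)).
    - by apply: measurable_funX; exact: mz.
    - by apply: measurable_funX; case: (sW i).
    - apply: ae_mono dz => t /[apply] dz; congr (_ ^+ 2).
      by rewrite !derive1E derive_mx// mxE.
  rewrite /W12norm B.
  set a := (X in (X + _)%E) in A *.
  have a0 : (0 <= a)%E by apply: integral_ge0 => t _; rewrite lee_fin sqr_ge0.
  have af : a \is a fin_num.
    by rewrite ge0_fin_numE// (le_lt_trans A)// ltry.
  rewrite -(fineK af) -EFinD poweR_EFin powR12_sqrt; last first.
    by rewrite addr_ge0// ?fine_ge0// sumr_ge0.
  rewrite lee_fin ler_wsqrtr// /r mulrDl mul1r lerD2r.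
  by rewrite -lee_fin fineK.
by apply: cvg_cst.
Unshelve. all: by end_near. Qed.

Lemma W12_cvgI (T : R) p (z_ : nat -> R -> 'rV[R]_p) (z : R -> 'rV[R]_p) :
  0 < T -> W12 T z -> (forall k, (0 < k)%N -> W12 T (z_ k)) ->
  (forall k, (0 < k)%N -> z_ k 0 = z 0) ->
  (forall i, veldist T (fun t => z_ k t 0 i) (fun t => z t 0 i)
     @[k --> \oo] --> 0) ->
  W12_cvg T z_ z.
Proof.
move=> T0 Wz Wk z0 dk; have T0' := ltW T0.
have ev : \forall k \near \oo, (0 < k)%N by exists 1%N.
split=> //; first by near=> k; apply: Wk; near: k.
have E k i : (fun t => (z_ k \- z) t 0 i) = (fun t => z_ k t 0 i - z t 0 i).
  by apply/funext => t; rewrite !mxE.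
have H : forall k, (0 < k)%N -> forall i, sW12 T (fun t => (z_ k \- z) t 0 i).
  move=> k k0 i; rewrite E; apply: (sW12_sub T0'); apply: (W12_coord _ T0').
    exact: Wk.
  exact: Wz.
apply: (W12norm_cvg0 T0).
- by move=> k k0; apply: W12_of_coord => // i; exact: H.
- by move=> k k0; rewrite /= z0// subrr.
- move=> i; apply: cvg_trans (dk i); apply: near_eq_cvg; near=> k.
  rewrite E (veldistE T0')//; apply: (W12_coord _ T0'); last exact: Wz.
  by apply: Wk; near: k.
Unshelve. all: by end_near. Qed.

Lemma le_Rintegral2 (T : R) (p q r : R -> R) :
  mu.-integrable `[0, T] (EFin \o p) -> mu.-integrable `[0, T] (EFin \o q) ->
  measurable_fun `[0, T] r -> (forall t, 0 <= r t <= 2 * p t + 2 * q t) ->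
  \int[mu]_(t in `[0, T]) r t <=
    2 * \int[mu]_(t in `[0, T]) p t + 2 * \int[mu]_(t in `[0, T]) q t.
Proof.
move=> ip iq mr rpq.
have jp := integrable_scale 2 ip; have jq := integrable_scale 2 iq.
have jpq : mu.-integrable `[0, T] (EFin \o (fun t => 2 * p t + 2 * q t)).
  exact: (integrableD _ jp jq).
rewrite -(RintegralZl _ _ ip)// -(RintegralZl _ _ iq)// -RintegralD//.
apply: le_Rintegral => //.
- apply: (le_integrable _ _ _ jpq) => //; first exact/measurable_EFinP.
  move=> t _ /=; have /andP[r0 r1] := rpq t.
  by rewrite lee_fin ger0_norm// ger0_norm// (le_trans r0).
- by move=> t _; have /andP[] := rpq t.
Qed.

Lemma veldist_sub_cvg (T : R) (f_ g_ : nat -> R -> R) (f g : R -> R) : 0 <= T ->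
  sW12 T f -> sW12 T g ->
  (forall k, (0 < k)%N -> sW12 T (f_ k)) ->
  (forall k, (0 < k)%N -> sW12 T (g_ k)) ->
  veldist T (f_ k) f @[k --> \oo] --> 0 ->
  veldist T (g_ k) g @[k --> \oo] --> 0 ->
  veldist T (fun t => f_ k t - g_ k t) (fun t => f t - g t) @[k --> \oo] --> 0.
Proof.
move=> T0 Wf Wg Wfk Wgk cf cg.
have H : (2 * veldist T (f_ k) f + 2 * veldist T (g_ k) g) @[k --> \oo] --> 0.
  rewrite -[X in _ --> X](_ : 2 * 0 + 2 * 0 = 0); last by rewrite mulr0 addr0.
  apply: cvgD; apply: cvgM; [exact: cvg_cst|exact: cf|exact: cvg_cst|exact: cg].
apply: (@squeeze_cvgr _ _ _ _ (cst 0) _ _ _ _ _ H); last exact: cvg_cst.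
near=> k; rewrite veldist_ge0/=.
have k0 : (0 < k)%N by near: k; exists 1%N.
have i1 := veldist_integrable T0 (Wfk _ k0) Wf.
have i2 := veldist_integrable T0 (Wgk _ k0) Wg.
have Wk := sW12_sub T0 (Wfk _ k0) (Wgk _ k0); have W := sW12_sub T0 Wf Wg.
have ae1 := derive1_sub_ae (Wfk _ k0) (Wgk _ k0).
have ae2 := derive1_sub_ae Wf Wg.
have m h : sW12 T h -> measurable_fun `[0, T] (derive1 h) by case.
have mm : measurable_fun `[0, T] (fun t =>
    ((derive1 (f_ k) t - derive1 (g_ k) t) - (derive1 f t - derive1 g t)) ^+ 2).
  apply/measurable_funX/measurable_funB.
    by apply: measurable_funB; [exact: m (Wfk _ k0)|exact: m (Wgk _ k0)].
  by apply: measurable_funB; [exact: m Wf|exact: m Wg].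
rewrite [leLHS](_ : _ = \int[mu]_(t in `[0, T])
   ((derive1 (f_ k) t - derive1 (g_ k) t) - (derive1 f t - derive1 g t)) ^+ 2);
  last first.
  congr fine; apply: ae_integral.
  - by apply/measurable_funX/measurable_funB; [exact: m Wk|exact: m W].
  - exact: mm.
  - by apply: ae_mono (ae_and ae1 ae2) => t [h1 h2] tT; rewrite h1// h2.
apply: (le_Rintegral2 i1 i2).
  exact: mm.
move=> t; rewrite sqr_ge0/=.
have := sqr_ge0
  ((derive1 (f_ k) t - derive1 f t) + (derive1 (g_ k) t - derive1 g t)).
nra.
Unshelve. all: by end_near. Qed.

End velocity_distance.

(** * Piecewise linear and step functions on a mesh *)

Section mesh_functions.
Context {R : realType}.
Notation mu := (@lebesgue_measure R).

(** Piecewise linear function on the mesh [t] with value [z0] at 0 and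
    slope [c j] on the [j]-th cell, written as a sum of ramps. *)
Definition plin (V : lmodType R) (k : nat) (t : nat -> R) (z0 : V)
    (c : nat -> V) (r : R) : V :=
  z0 + \sum_(j < k) (Num.min r (t j.+1) - Num.min r (t j)) *: c j.

(** Scalar version of [plin]. *)
Definition splin (k : nat) (t : nat -> R) (z0 : R) (c : nat -> R) (r : R) : R :=
  z0 + \sum_(j < k) (Num.min r (t j.+1) - Num.min r (t j)) * c j.

(** Step function with value [c j] on the half-open [j]-th cell. *)
Definition step (k : nat) (t : nat -> R) (c : nat -> R) (r : R) : R :=
  \sum_(j < k) c j * \1_`[t j, t j.+1[ r.

Lemma plin_coord p k t (z0 : 'rV[R]_p) c r i :
  plin k t z0 c r 0 i = splin k t (z0 0 i) (fun j => c j 0 i) r.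
Proof.
rewrite /plin /splin mxE summxE; congr (_ + _).
by apply: eq_bigr => j _; rewrite mxE.
Qed.

Section one_mesh.
Variables (T : R) (k : nat) (t : nat -> R).
Hypothesis k0 : (0 < k)%N.
Hypothesis mesh : is_mesh T k t.

Lemma mesh_lt i j : (i < j)%N -> (j <= k)%N -> t i < t j.
Proof.
case: mesh => _ _ H; elim: j => // j IH; rewrite ltnS leq_eqVlt.
move=> /predU1P[->|ij] jk; first by case: (H j jk).
by apply: (lt_trans (IH ij (ltnW jk))); case: (H j jk).
Qed.

Lemma mesh_le i j : (i <= j)%N -> (j <= k)%N -> t i <= t j.
Proof. by rewrite leq_eqVlt => /predU1P[->//|ij] /(mesh_lt ij)/ltW. Qed.

Lemma mesh_ge0 j : (j <= k)%N -> 0 <= t j.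
Proof. by move=> jk; have [<- _ _] := mesh; exact: mesh_le. Qed.

Lemma mesh_leT j : (j <= k)%N -> t j <= T.
Proof. by move=> jk; have [_ <- _] := mesh; exact: mesh_le. Qed.

Lemma mesh_itv j : (j <= k)%N -> t j \in `[0, T].
Proof. by move=> jk; rewrite in_itv/= mesh_ge0// mesh_leT. Qed.

Lemma mesh_T0 : 0 < T.
Proof. by have [t0 tT _] := mesh; rewrite -tT -t0; exact: mesh_lt. Qed.

Lemma mesh_h j : (j < k)%N -> 0 < t j.+1 - t j.
Proof. by move=> jk; rewrite subr_gt0; exact: mesh_lt. Qed.

Lemma plinE (V : lmodType R) (z0 : V) c j r : (j < k)%N ->
  r \in `[t j, t j.+1] -> plin k t z0 c r =
    z0 + \sum_(i < j) (t i.+1 - t i) *: c i + (r - t j) *: c j.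
Proof.
rewrite in_itv/= => jk /andP[tr rt].
rewrite /plin -addrA; congr (_ + _).
rewrite -(big_mkord xpredT
  (fun i => (Num.min r (t i.+1) - Num.min r (t i)) *: c i)).
rewrite -(big_mkord xpredT (fun i => (t i.+1 - t i) *: c i)).
rewrite (big_cat_nat (n := j)) //=; last exact: ltnW.
congr (_ + _).
  rewrite big_nat_cond [RHS]big_nat_cond; apply: eq_bigr => i.
  rewrite andbT => /andP[_ ij].
  have a : t i.+1 <= r by apply: le_trans tr; apply: mesh_le => //; exact: ltnW.
  have b : t i <= r.
    by apply: le_trans a; apply: mesh_le => //; exact: (leq_trans ij (ltnW jk)).
  by rewrite (min_idPr a) (min_idPr b).
rewrite big_ltn// (min_idPl rt) (min_idPr tr) big_nat_cond big1 ?addr0// => i.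
rewrite andbT => /andP[ji ik].
have a : r <= t i by apply: (le_trans rt); apply: mesh_le => //; exact: ltnW.
have b : r <= t i.+1 by apply: (le_trans a); apply: mesh_le.
by rewrite (min_idPl a) (min_idPl b) subrr scale0r.
Qed.

Lemma plin_mesh (V : lmodType R) (z0 : V) c j : (j <= k)%N ->
  plin k t z0 c (t j) = z0 + \sum_(i < j) (t i.+1 - t i) *: c i.
Proof.
rewrite leq_eqVlt => /predU1P[->|jk]; last first.
  rewrite (plinE _ _ jk) ?subrr ?scale0r ?addr0// in_itv/= lexx/=.
  exact: mesh_le.
have e := prednK k0; have kk : (k.-1 < k)%N by rewrite e.
have -> : t k = t k.-1.+1 by rewrite e.
rewrite (plinE _ _ kk); last by rewrite in_itv/= lexx andbT mesh_le.
by rewrite -[in RHS]e big_ord_recr/= addrA.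
Qed.

Lemma plin_slopes p (z0 : 'rV[R]_p) c : linear_with_slopes k t (plin k t z0 c) c.
Proof.
by move=> j jk r rj; rewrite (plinE _ _ jk rj) plin_mesh// ltnW.
Qed.

Lemma plin0 (V : lmodType R) (z0 : V) c : plin k t z0 c 0 = z0.
Proof. by have [t0 _ _] := mesh; rewrite -t0 plin_mesh// big_ord0 addr0. Qed.

Lemma plin_succ (V : lmodType R) (z0 : V) c j : (j < k)%N ->
  plin k t z0 c (t j.+1) = plin k t z0 c (t j) + (t j.+1 - t j) *: c j.
Proof.
by move=> jk; rewrite !plin_mesh//; [rewrite big_ord_recr/= addrA|exact: ltnW].
Qed.

Lemma plin_nodes (V : lmodType R) (z : nat -> V) j : (j <= k)%N ->
  plin k t (z 0%N) (fun j => (t j.+1 - t j)^-1 *: (z j.+1 - z j)) (t j) = z j.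
Proof.
elim: j => [|j IH] jk; first by have [-> _ _] := mesh; rewrite plin0.
rewrite plin_succ// IH; last exact: ltnW.
by rewrite scalerA divff ?scale1r ?subrKC// gt_eqF// mesh_h.
Qed.

Lemma mesh_find r : 0 <= r < T -> exists2 j, (j < k)%N & t j <= r < t j.+1.
Proof.
move=> /andP[r0 rT]; have [t0 tT _] := mesh.
suff : forall m, (m <= k)%N -> r < t m -> exists2 j, (j < m)%N & t j <= r < t j.+1.
  by move=> /(_ k (leqnn k)); rewrite tT; exact.
elim=> [|m IH] mk; first by rewrite t0 ltNge r0.
move=> rm; have [/(IH (ltnW mk))[j jm H]|mr] := ltP r (t m).
  by exists j => //; exact: ltnW.
by exists m => //; rewrite mr.
Qed.

Lemma stepE c j r : (j < k)%N -> t j <= r < t j.+1 -> step k t c r = c j.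
Proof.
move=> jk /andP[jr rj]; rewrite /step (bigD1 (Ordinal jk))//=.
rewrite indicE mem_set/=; last first.
  by rewrite in_itv/= jr rj.
rewrite mulr1 big1 ?addr0// => i ij; rewrite indicE memNset ?mulr0//=.
rewrite in_itv/=; apply/negP; rewrite negb_and -ltNge -leNgt.
have : (i != j :> nat)%N by [].
rewrite neq_ltn => /orP[ilj|jli].
  by apply/orP; right; apply: le_trans jr; apply: mesh_le => //; exact: ltnW.
apply/orP; left; apply: (lt_le_trans rj); apply: mesh_le => //; exact: ltnW.
Qed.

Lemma measurable_step c (D : set R) : measurable_fun D (step k t c).
Proof.
apply: measurable_sum => j; apply: measurable_funM => //.
Qed.

Lemma splin_sW12 z0 c : sW12 T (splin k t z0 c).
Proof.
have T0 := ltW mesh_T0.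
have H : sW12 T (fun r =>
    \sum_(j < k) c j * (Num.min r (t j.+1) - Num.min r (t j))).
  apply: (sW12_sum _ T0) => j; apply: (sW12_scale _ T0).
  by apply: (sW12_sub T0); apply: sW12_ramp; rewrite mesh_ge0 ?mesh_leT// ltnW.
have := sW12_lin 1 T0 (sW12_cst z0 T0) H; congr sW12; apply/funext => r.
by rewrite mul1r /splin; congr (_ + _); apply: eq_bigr => j _; rewrite mulrC.
Qed.

Lemma splin_derive1 z0 c j r : (j < k)%N -> t j < r < t j.+1 ->
  derive1 (splin k t z0 c) r = c j.
Proof.
move=> jk /andP[jr rj].
have E s : s \in `]t j, t j.+1[ -> (z0 + \sum_(i < j) (t i.+1 - t i) * c i
     - t j * c j) + c j * s = splin k t z0 c s.
  rewrite in_itv/= => /andP[js sj].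
  have := @plinE R^o z0 c j s jk; rewrite in_itv/= !ltW// => /(_ isT) H.
  rewrite [RHS]H /GRing.scale/=; ring.
rewrite derive1E; set a := (X in forall s, _ -> X + _ = _) in E.
have H : is_derive r (1:R) (cst a + c j \*: id) (0 + c j *: (1:R)).
  by apply: is_deriveD; apply: is_deriveZ.
have [_ <-] : is_derive r (1:R) (splin k t z0 c) (c j); last by [].
apply: (@near_eq_is_derive _ _ _ (cst a + c j \*: id)).
  have : r \in `]t j, t j.+1[ by rewrite in_itv/= jr rj.
  by move=> /near_in_itvoo; apply: filterS => s; rewrite inE => sI; exact: E.
by move: H; rewrite add0r /GRing.scale/= mulr1.
Qed.

Lemma splin_derive1_ae z0 c : {ae mu, forall r : R, r \in `[0, T] ->
  derive1 (splin k t z0 c) r = step k t c r}.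
Proof.
have := ae_forall (fun j : 'I_k.+1 => ae_neq (t j)).
apply: ae_mono => r H; rewrite in_itv/= => /andP[r0 rT].
have [_ tT _] := mesh.
have {}rT : r < T by rewrite lt_neqAle rT andbT -tT; have /= := H ord_max.
have [j jk /andP[jr rj]] : exists2 j, (j < k)%N & t j <= r < t j.+1.
  by apply: mesh_find; rewrite r0.
rewrite (stepE _ jk) ?jr// (splin_derive1 _ _ jk)// rj andbT lt_neqAle jr andbT.
by rewrite eq_sym; have /= := H (Ordinal (ltnW jk : (j < k.+1)%N)).
Qed.

Lemma splin_veldist z0 c f : sW12 T f ->
  veldist T (splin k t z0 c) f =
  \int[mu]_(r in `[0, T]) (step k t c r - derive1 f r) ^+ 2.
Proof.
move=> [_ mf _ _]; congr fine; apply: ae_integral.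
- by apply/measurable_funX/measurable_funB => //; case: (splin_sW12 z0 c).
- by apply/measurable_funX/measurable_funB => //; exact: measurable_step.
- by apply: ae_mono (splin_derive1_ae z0 c) => r /[apply] ->.
Qed.

Lemma Rintegral_itv_split (F : R -> R) (a b : R) : 0 <= a -> a <= b -> b <= T ->
  mu.-integrable `[0, T] (EFin \o F) ->
  \int[mu]_(r in `[0, b]) F r =
    \int[mu]_(r in `[0, a]) F r + \int[mu]_(r in `[a, b]) F r.
Proof.
move=> a0 ab bT iF.
have iFb : mu.-integrable `[0, b] (EFin \o F).
  by apply: integrable_prefix iF; rewrite in_itv/= (le_trans a0).
apply/eqP; rewrite addrC -subr_eq; apply/eqP.
rewrite (Rintegral_itvB iFb) ?bnd_simp// Rintegral_itv_obnd_cbnd//.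
by apply: integrableS iFb => //; apply: subset_itvr; rewrite bnd_simp.
Qed.

Lemma Rintegral_mesh (F : R -> R) : mu.-integrable `[0, T] (EFin \o F) ->
  \int[mu]_(r in `[0, T]) F r =
    \sum_(j < k) \int[mu]_(r in `[t j, t j.+1]) F r.
Proof.
move=> iF; have [t0 tT _] := mesh; rewrite -[in LHS]tT.
suff : forall m, (m <= k)%N -> \int[mu]_(r in `[0, t m]) F r =
    \sum_(j < m) \int[mu]_(r in `[t j, t j.+1]) F r by exact.
elim=> [|m IH] mk; first by rewrite t0 big_ord0 set_itv1 Rintegral_set1.
rewrite big_ord_recr/= -IH; last exact: ltnW.
apply: Rintegral_itv_split => //; first by apply: mesh_ge0; exact: ltnW.
  by apply: mesh_le.
exact: mesh_leT.
Qed.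

Lemma integrable_mesh (F : R -> R) j : (j < k)%N ->
  mu.-integrable `[0, T] (EFin \o F) ->
  mu.-integrable `[t j, t j.+1] (EFin \o F).
Proof.
move=> jk; apply: integrableS => //.
by apply: subset_itv; rewrite bnd_simp ?mesh_ge0 ?mesh_leT// ltnW.
Qed.

Lemma integrable_ae_eq (F G : R -> R) : measurable_fun `[0, T] G ->
  {ae mu, forall r : R, r \in `[0, T] -> F r = G r} ->
  mu.-integrable `[0, T] (EFin \o F) -> mu.-integrable `[0, T] (EFin \o G).
Proof.
move=> mG FG /integrableP[mF iF]; apply/integrableP; split.
  exact/measurable_EFinP.
have mF' : measurable_fun `[0, T] F by exact/measurable_EFinP.
move: iF; rewrite (@ae_integral _ _ (fun r => `|F r|) (fun r => `|G r|))//.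
- by apply: measurableT_comp.
- by apply: measurableT_comp.
- by apply: ae_mono FG => r /[apply] ->.
Qed.

Lemma step_sq_integrable c :
  mu.-integrable `[0, T] (EFin \o (fun r => step k t c r ^+ 2)).
Proof.
apply: integrable_ae_eq (sW12_sq_integrable (splin_sW12 0 c)).
- by apply: measurable_funX; exact: measurable_step.
- by apply: ae_mono (splin_derive1_ae 0 c) => r /[apply] ->.
Qed.

Lemma eq_Rintegral_mesh (F G : R -> R) j : (j < k)%N ->
  measurable_fun `[0, T] F -> measurable_fun `[0, T] G ->
  (forall r, t j < r < t j.+1 -> F r = G r) ->
  \int[mu]_(r in `[t j, t j.+1]) F r = \int[mu]_(r in `[t j, t j.+1]) G r.
Proof.
move=> jk mF mG FG.
have s : `]t j, t j.+1[ `<=` `[0, T].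
  by apply: subset_itv; rewrite bnd_simp ?mesh_ge0 ?mesh_leT// ltnW.
congr fine; apply: eq_integral_itv_bounded.
- exact: measurable_funS mF.
- exact: measurable_funS mG.
- by move=> r; rewrite in_itv/=; exact: FG.
Qed.

Lemma Rintegral_mesh_cst (c : R) j : (j < k)%N ->
  \int[mu]_(r in `[t j, t j.+1]) c = c * (t j.+1 - t j).
Proof.
move=> jk; rewrite (@Rintegral_cst _ _ _ mu)//= lebesgue_measure_itv/= lte_fin.
by rewrite mesh_lt.
Qed.

Lemma step_sq_Rintegral c : \int[mu]_(r in `[0, T]) (step k t c r ^+ 2) =
  \sum_(j < k) (t j.+1 - t j) * c j ^+ 2.
Proof.
rewrite (Rintegral_mesh (step_sq_integrable c)); apply: eq_bigr => j _.
rewrite mulrC -Rintegral_mesh_cst//; apply: eq_Rintegral_mesh => //.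
- by apply: measurable_funX; exact: measurable_step.
- by move=> r /andP[jr rj]; rewrite (stepE _ (ltn_ord j))// rj ltW.
Qed.

Lemma sW12_incr f j : sW12 T f -> (j < k)%N ->
  f (t j.+1) - f (t j) = \int[mu]_(r in `[t j, t j.+1]) derive1 f r.
Proof.
move=> Wf jk; have [_ _ _ rep] := Wf.
rewrite (rep (t j.+1)) ?mesh_itv// (rep (t j)) ?mesh_itv//; last exact: ltnW.
rewrite (@Rintegral_itv_split _ (t j) (t j.+1)) ?mesh_ge0 ?mesh_leT ?mesh_le//.
- by ring.
- exact: ltnW.
- exact: sW12_integrable.
Qed.

(** Mean velocity of [f] on the [j]-th cell. *)
Definition mean_vel (f : R -> R) (j : nat) : R :=
  (t j.+1 - t j)^-1 * (f (t j.+1) - f (t j)).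

Lemma cell_variance f j : sW12 T f -> (j < k)%N ->
  \int[mu]_(r in `[t j, t j.+1]) (mean_vel f j - derive1 f r) ^+ 2 =
  \int[mu]_(r in `[t j, t j.+1]) (derive1 f r ^+ 2)
    - (t j.+1 - t j) * mean_vel f j ^+ 2.
Proof.
move=> Wf jk; set c := mean_vel f j.
have i1 := integrable_mesh jk (sW12_integrable Wf).
have i2 := integrable_mesh jk (sW12_sq_integrable Wf).
have mj : measurable (`[t j, t j.+1] : set R) by [].
have i3 : mu.-integrable `[t j, t j.+1]
    (EFin \o (fun r => (- (2 * c)) * derive1 f r)).
  by exact: (integrableZl _ _ i1).
have i4 : mu.-integrable `[t j, t j.+1] (EFin \o cst (c ^+ 2)).
  exact: integrable_cst_itv.
have i34 : mu.-integrable `[t j, t j.+1]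
    (EFin \o (fun r => (- (2 * c)) * derive1 f r + c ^+ 2)).
  exact: (integrableD _ i3 i4).
transitivity (\int[mu]_(r in `[t j, t j.+1])
    (derive1 f r ^+ 2 + ((- (2 * c)) * derive1 f r + c ^+ 2))).
  by apply: eq_Rintegral => r _; ring.
rewrite RintegralD// (RintegralD _ i3 i4)// RintegralZl// Rintegral_mesh_cst//.
rewrite -sW12_incr//.
have -> : f (t j.+1) - f (t j) = (t j.+1 - t j) * c.
  by rewrite /c /mean_vel mulrA divff ?mul1r// gt_eqF// mesh_h.
by ring.
Qed.

(** The step function of mean velocities is the orthogonal projection of
    the velocity onto the step functions. *)
Lemma mean_vel_variance f : sW12 T f ->
  \int[mu]_(r in `[0, T]) (step k t (mean_vel f) r - derive1 f r) ^+ 2 =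
  \int[mu]_(r in `[0, T]) (derive1 f r ^+ 2)
  - \int[mu]_(r in `[0, T]) (step k t (mean_vel f) r ^+ 2).
Proof.
move=> Wf; have T0 := ltW mesh_T0; have [_ mf _ _] := Wf.
have msf : measurable_fun `[0, T] (fun r =>
    (step k t (mean_vel f) r - derive1 f r) ^+ 2).
  apply: measurable_funX; apply: measurable_funB => //; exact: measurable_step.
have i0 : mu.-integrable `[0, T]
    (EFin \o (fun r => (step k t (mean_vel f) r - derive1 f r) ^+ 2)).
  apply: integrable_ae_eq
    (veldist_integrable T0 (splin_sW12 0 (mean_vel f)) Wf) => //.
  by apply: ae_mono (splin_derive1_ae 0 (mean_vel f)) => r /[apply] ->.
rewrite (Rintegral_mesh i0) (Rintegral_mesh (sW12_sq_integrable Wf)).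
rewrite step_sq_Rintegral -sumrB; apply: eq_bigr => j _.
rewrite -(cell_variance Wf (ltn_ord j)); apply: eq_Rintegral_mesh => //.
  by apply: measurable_funX; apply: measurable_funB.
by move=> r /andP[jr rj]; rewrite (stepE _ (ltn_ord j))// rj ltW.
Qed.

(** A step function with nonnegative values of bounded sum has a small L2
    norm on a fine mesh. *)
Lemma step_sq_bound (K : R) D : (forall j, (j < k)%N -> 0 <= D j) ->
  \sum_(j < k) D j <= K ->
  \int[mu]_(r in `[0, T]) (step k t D r ^+ 2) <= T / k%:R * K ^+ 2.
Proof.
move=> D0 DK; rewrite step_sq_Rintegral; have [_ _ H] := mesh.
have T0 := ltW mesh_T0.
have Dj (j : 'I_k) : D j <= K.
  apply: le_trans DK; rewrite (bigD1 j)//= lerDl sumr_ge0// => i _.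
  exact: D0.
have K0 : 0 <= K by apply: le_trans (Dj (Ordinal k0)); exact: D0.
apply: (@le_trans _ _ (\sum_(j < k) T / k%:R * (K * D j))).
  apply: ler_sum => j _; apply: ler_pM.
  - by rewrite ltW// mesh_h.
  - exact: sqr_ge0.
  - by case: (H j (ltn_ord j)).
  - by rewrite expr2 ler_wpM2r// D0.
rewrite -mulr_sumr -mulr_sumr expr2 ler_wpM2l ?divr_ge0// ler_wpM2l//.
Qed.

End one_mesh.

Lemma veldist_ae_bound (T e : R) (f g G : R -> R) : 0 < T -> 0 <= e ->
  sW12 T f -> sW12 T g ->
  mu.-integrable `[0, T] (EFin \o (fun r => G r ^+ 2)) ->
  measurable_fun `[0, T] G ->
  {ae mu, forall r : R, r \in `[0, T] ->
    `|derive1 f r - derive1 g r| <= e + `|G r|} ->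
  veldist T f g <= 2 * (e ^+ 2 * T) + 2 * \int[mu]_(r in `[0, T]) (G r ^+ 2).
Proof.
move=> T0 e0 Wf Wg iG mG H.
have ic : mu.-integrable `[0, T] (EFin \o cst (e ^+ 2)).
  exact: integrable_cst_itv.
(* truncation makes the a.e. bound hold everywhere *)
pose r_ (r : R) := Num.min ((derive1 f r - derive1 g r) ^+ 2)
  (2 * e ^+ 2 + 2 * G r ^+ 2).
have mfg : measurable_fun `[0, T] (fun r => (derive1 f r - derive1 g r) ^+ 2).
  by apply: measurable_funX; apply: measurable_funB; [case: Wf|case: Wg].
have mr : measurable_fun `[0, T] r_.
  apply: measurable_minr => //; apply: measurable_funD => //.
  by apply: measurable_funM => //; exact: measurable_funX.
have -> : veldist T f g = \int[mu]_(r in `[0, T]) r_ r.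
  congr fine; apply: ae_integral => //.
  apply: ae_mono H => r /[apply] H; rewrite /r_; symmetry; apply/min_idPl.
  rewrite -real_normK ?num_real//.
  apply: (@le_trans _ _ ((e + `|G r|) ^+ 2)).
    by rewrite lerXn2r// nnegrE addr_ge0.
  rewrite -[G r ^+ 2]real_normK ?num_real//; have := sqr_ge0 (e - `|G r|); nra.
have -> : e ^+ 2 * T = \int[mu]_(r in `[0, T]) (cst (e ^+ 2) r).
  rewrite (@Rintegral_cst _ _ _ mu)//= lebesgue_measure_itv/= lte_fin T0/=.
  by rewrite subr0.
apply: (le_Rintegral2 ic iG mr) => r.
rewrite /r_ le_min sqr_ge0/= ge_min lexx orbT andbT.
by rewrite addr_ge0// mulr_ge0// sqr_ge0.
Qed.

End mesh_functions.

(** * Convergence along a sequence of meshes *)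

Section mesh_functions_seq.
Context {R : realType}.
Notation mu := (@lebesgue_measure R).

Section mesh_sequence.
Variables (T : R) (t : nat -> nat -> R).
Hypothesis T0 : 0 < T.
Hypothesis mesh : forall k, (0 < k)%N -> is_mesh T k (t k).

Lemma cvg_Tk : T / k%:R @[k --> \oo] --> 0.
Proof.
rewrite -(mulr0 T); apply: cvgM; first exact: cvg_cst.
apply/cvgrPdist_lt => e e0.
have := @cvg_harmonic R => /cvgrPdist_lt /(_ e e0) [N _ HN].
exists N.+1 => // -[|n] //= Nn; exact: HN.
Qed.

(** A derivative is the limit of the difference quotients over intervals
    shrinking to the point, the point being allowed to lie inside. *)
Lemma mean_vel_ptwise (f : R -> R) (r : R) : derivable f r (1:R) ->
  r \in `[0, T] -> r != T ->
  step k (t k) (mean_vel (t k) f) r @[k --> \oo] --> derive1 f r.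
Proof.
rewrite in_itv/= => df /andP[r0 rT'] rT.
have {rT' rT}rT : r < T by rewrite lt_neqAle rT.
apply/cvgrPdist_le => e e0.
have [d d0 Hd] : exists2 d, 0 < d & forall s, `|s - r| < d ->
    `|f s - f r - (s - r) * derive1 f r| <= e * `|s - r|.
  move: df => /cvg_ex[l dl].
  have El : derive1 f r = l by rewrite derive1E /derive; exact: cvg_lim dl.
  move/cvgrPdist_le : dl => /(_ e e0); rewrite /dnbhs/within/= => -[d /= d0 Hd].
  exists d => // s sd; have [->|sr] := eqVneq s r.
    by rewrite !subrr mul0r subrr normr0 mulr0.
  have := Hd (s - r); rewrite /ball_/= sub0r normrN => /(_ sd).
  rewrite subr_eq0 => /(_ sr); rewrite /GRing.scale/= mulr1 subrK El.
  have n0 : 0 < `|s - r| by rewrite normr_gt0 subr_eq0.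
  rewrite -(ler_pM2r n0) -normrM mulrBl mulrAC mulVf ?subr_eq0// mul1r.
  by rewrite [l * _]mulrC distrC.
have := cvg_Tk => /cvgrPdist_lt /(_ _ d0) Hk.
near=> k.
have k0 : (0 < k)%N by near: k; exists 1%N.
have mk := mesh k0.
have [j jk /andP[jr rj]] : exists2 j, (j < k)%N & t k j <= r < t k j.+1.
  by apply: (mesh_find mk); rewrite r0.
rewrite (stepE mk _ jk) ?jr//.
have h0 := mesh_h mk jk.
have hd : t k j.+1 - t k j < d.
  have [_ _ /(_ _ jk)[_ hk]] := mk; apply: (le_lt_trans hk).
  have : `|0 - T / k%:R| < d by near: k.
  by rewrite sub0r normrN; apply: le_lt_trans; exact: ler_norm.
have A : `|f (t k j.+1) - f r - (t k j.+1 - r) * derive1 f r| <= e * (t k j.+1 - r).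
  by have := Hd (t k j.+1); rewrite ger0_norm ?subr_ge0 ?(ltW rj)//; apply; lra.
have B : `|f (t k j) - f r - (t k j - r) * derive1 f r| <= e * (r - t k j).
  have := Hd (t k j); rewrite distrC ger0_norm ?subr_ge0//; apply; lra.
rewrite -(ler_pM2l h0) -[X in X * _](gtr0_norm h0) -normrM /mean_vel mulrBr mulrA.
rewrite divff ?gt_eqF// mul1r.
rewrite (le_trans _ (_ : e * (t k j.+1 - r) + e * (r - t k j) <= _))//;
  last lra.
apply: le_trans (lerD A B); apply: le_trans (ler_normB _ _).
rewrite -normrN le_eqVlt; apply/orP; left; apply/eqP; congr `|_|; ring.
Unshelve. all: by end_near. Qed.

Lemma mean_vel_cvg f (z0 : nat -> R) : sW12 T f ->
  veldist T (splin k (t k) (z0 k) (mean_vel (t k) f)) f @[k --> \oo] --> 0.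
Proof.
move=> Wf; have [df mf foo _] := Wf.
(* positive part of the defect of norm *)
pose F k r := Num.max (derive1 f r ^+ 2 - step k (t k) (mean_vel (t k) f) r ^+ 2) 0.
have mF k : measurable_fun `[0, T] (F k).
  apply: measurable_maxr => //; apply: measurable_funB; apply: measurable_funX => //.
  exact: measurable_step.
have F0 k r : 0 <= F k r by rewrite /F le_max lexx orbT.
have Ff k r : F k r <= derive1 f r ^+ 2.
  by rewrite /F ge_max sqr_ge0 andbT lerBlDr lerDl sqr_ge0.
have cF : (\int[mu]_(r in `[0%R, T]) (F k r)%:E)%E @[k --> \oo] --> (0:R)%:E.
  have [] := @dominated_convergence _ _ R mu `[0, T]%classic (measurable_itv _)
    (fun k => EFin \o F k) (cst 0%E) (EFin \o (fun r => derive1 f r ^+ 2)).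
  - by move=> k; apply/measurable_EFinP; exact: mF.
  - exact: measurable_cst.
  - have aT := ae_neq T.
    apply: ae_mono (ae_and df aT) => r [df' rT] rI.
    have {}df' := df' rI.
    have c := mean_vel_ptwise df' rI rT.
    apply: cvg_EFin; first by apply: nearW.
    have -> : (0:R) = Num.max (derive1 f r ^+ 2 - derive1 f r ^+ 2) 0.
      by rewrite subrr maxxx.
    have c2 : derive1 f r ^+ 2 - step k (t k) (mean_vel (t k) f) r ^+ 2
        @[k --> \oo] --> derive1 f r ^+ 2 - derive1 f r ^+ 2.
      apply: cvgB; first exact: cvg_cst.
      by rewrite expr2; under eq_fun do rewrite expr2; exact: (cvgM c c).
    have := @continuous_max R R id (cst 0) (derive1 f r ^+ 2 - derive1 f r ^+ 2).
    move=> /(_ (fun=> id) (cvg_cst _)) H.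
    apply: (@cvg_comp _ _ _
      (fun k => derive1 f r ^+ 2 - step k (t k) (mean_vel (t k) f) r ^+ 2)
      (fun x => Num.max x 0) _ _ _ c2).
    exact: H.
  - exact: sq_integrable.
  - apply: aeW => r k _ /=; rewrite lee_fin ger0_norm//.
  - by move=> _ _; rewrite integral0.
have {}cF : \int[mu]_(r in `[0, T]) F k r @[k --> \oo] --> 0.
  exact: (fine_cvg cF).
apply: (@squeeze_cvgr _ _ _ _ (cst 0) _ _ _ _ _ cF); last exact: cvg_cst.
near=> k; rewrite veldist_ge0/=.
have k0 : (0 < k)%N by near: k; exists 1%N.
have mk := mesh k0.
rewrite (splin_veldist k0 mk _ _ Wf) (mean_vel_variance k0 mk Wf).
have i1 := sq_integrable mf foo.
have i2 := step_sq_integrable k0 mk (mean_vel (t k) f).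
rewrite -RintegralB//.
have ms : measurable_fun `[0, T] (fun r => step k (t k) (mean_vel (t k) f) r ^+ 2).
  by apply: measurable_funX; exact: measurable_step.
apply: le_Rintegral => //.
- exact: (integrableB _ i1 i2).
- apply: (le_integrable _ _ _ i1) => //.
    by apply/measurable_EFinP; exact: mF.
  by move=> r _ /=; rewrite lee_fin ger0_norm// ger0_norm ?sqr_ge0.
- by move=> r _; rewrite /F le_max lexx.
Unshelve. all: by end_near. Qed.

(** Changing the slopes by a vanishing amount does not affect
    convergence. *)
Lemma veldist_perturb_cvg f (z0 : nat -> R) (c c' : nat -> nat -> R) (e : nat -> R) :
  sW12 T f -> (forall k j, (0 < k)%N -> (j < k)%N -> `|c' k j - c k j| <= e k) ->
  e k @[k --> \oo] --> 0 ->
  veldist T (splin k (t k) (z0 k) (c k)) f @[k --> \oo] --> 0 ->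
  veldist T (splin k (t k) (z0 k) (c' k)) f @[k --> \oo] --> 0.
Proof.
move=> Wf cc e0 cf.
have H : (2 * (e k ^+ 2 * T) + 2 * veldist T (splin k (t k) (z0 k) (c k)) f)
    @[k --> \oo] --> 0.
  have -> : (0 : R) = 2 * (0 * 0 * T) + 2 * 0 by rewrite !mulr0 mul0r mulr0 addr0.
  apply: cvgD; (apply: cvgM; first exact: cvg_cst); last exact: cf.
  apply: cvgM; last exact: cvg_cst.
  by under eq_fun do rewrite expr2; exact: (cvgM e0 e0).
apply: (@squeeze_cvgr _ _ _ _ (cst 0) _ _ _ _ _ H); last exact: cvg_cst.
near=> k; rewrite veldist_ge0/=.
have k0 : (0 < k)%N by near: k; exists 1%N.
have mk := mesh k0; have [_ mf _ _] := Wf.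
have W' := splin_sW12 k0 mk (z0 k) (c' k); have W := splin_sW12 k0 mk (z0 k) (c k).
have ek : 0 <= e k by apply: le_trans (cc k 0%N k0 k0).
apply: (veldist_ae_bound T0 ek W' Wf).
- exact: veldist_integrable (ltW T0) W Wf.
- by apply: measurable_funB; [case: W|case: Wf].
have aT := ae_neq T.
apply: ae_mono (ae_and aT (ae_and (splin_derive1_ae mk (z0 k) (c' k))
  (splin_derive1_ae mk (z0 k) (c k)))).
move=> r [rT [E' E]] rI; rewrite E'// E//.
have [j jk rj] : exists2 j, (j < k)%N & t k j <= r < t k j.+1.
  apply: (mesh_find mk); move: rI; rewrite in_itv/= => /andP[-> rT'].
  by rewrite lt_neqAle rT.
rewrite !(stepE mk _ jk rj) -(subrKA (c k j)) (le_trans (ler_normD _ _))//.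
by rewrite lerD2r; exact: cc.
Unshelve. all: by end_near. Qed.

(** The slopes may miss the velocity by [D k j] on the [j]-th cell
    provided that the sum of the [D k j] over [j] stays bounded. *)
Lemma veldist_step_cvg f (z0 : nat -> R) (c D : nat -> nat -> R) (K : R) :
  sW12 T f ->
  (forall k j, (0 < k)%N -> (j < k)%N -> 0 <= D k j) ->
  (forall k, (0 < k)%N -> \sum_(j < k) D k j <= K) ->
  (forall e, 0 < e -> \forall k \near \oo,
     {ae mu, forall r : R, r \in `[0, T] -> forall j,
     (j < k)%N -> t k j < r < t k j.+1 ->
     `|c k j - derive1 f r| <= e + D k j}) ->
  veldist T (splin k (t k) (z0 k) (c k)) f @[k --> \oo] --> 0.
Proof.
move=> Wf D0 DK near_ae; apply/cvgrPdist_le => eps eps0.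
pose e := Num.min 1 (eps / (4 * T)).
have e0 : 0 < e by rewrite lt_min ltr01 divr_gt0// mulr_gt0.
have e1 : e <= 1 by rewrite ge_min lexx.
have e2 : 4 * (e * T) <= eps.
  have : e <= eps / (4 * T) by rewrite ge_min lexx orbT.
  by rewrite ler_pdivlMr ?mulr_gt0// mulrC -mulrA [T * e]mulrC.
have cK : 2 * (T / k%:R * K ^+ 2) @[k --> \oo] --> 0.
  have -> : (0 : R) = 2 * (0 * K ^+ 2) by rewrite mul0r mulr0.
  apply: cvgM; first exact: cvg_cst.
  by apply: cvgM; [exact: cvg_Tk|exact: cvg_cst].
have eps2 : 0 < eps / 2 by rewrite divr_gt0.
have := near_ae e e0 => {}near_ae.
move/cvgrPdist_le : cK => /(_ _ eps2) cK.
near=> k; rewrite sub0r normrN ger0_norm ?veldist_ge0//.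
have k0 : (0 < k)%N by near: k; exists 1%N.
have mk := mesh k0.
have ae : {ae mu, forall r : R, r \in `[0, T] -> forall j,
     (j < k)%N -> t k j < r < t k j.+1 ->
     `|c k j - derive1 f r| <= e + D k j} by near: k.
have bK : 2 * (T / k%:R * K ^+ 2) <= eps / 2.
  have : `|0 - 2 * (T / k%:R * K ^+ 2)| <= eps / 2 by near: k.
  by rewrite sub0r normrN; apply: le_trans; exact: ler_norm.
apply: (@le_trans _ _ (2 * (e ^+ 2 * T) +
    2 * \int[mu]_(r in `[0, T]) (step k (t k) (D k) r ^+ 2))); last first.
  have : e ^+ 2 * T <= e * T by rewrite ler_pM2r// expr2 ger_pMr.
  have := step_sq_bound k0 mk (fun j jk => D0 k j k0 jk) (DK k k0).
  lra.
have W := splin_sW12 k0 mk (z0 k) (c k).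
apply: (veldist_ae_bound T0 (ltW e0) W Wf).
- exact: (step_sq_integrable k0 mk).
- exact: measurable_step.
have an := ae_forall (fun j : 'I_k.+1 => ae_neq (t k j)).
apply: ae_mono (ae_and an (ae_and (splin_derive1_ae mk (z0 k) (c k)) ae)).
move=> r [rn [E B]] rI; rewrite E//.
have [_ tT _] := mk.
have rT : r != T by rewrite -tT; have /= := rn ord_max.
have [j jk rj] : exists2 j, (j < k)%N & t k j <= r < t k j.+1.
  apply: (mesh_find mk); move: rI; rewrite in_itv/= => /andP[-> rT'].
  by rewrite lt_neqAle rT.
rewrite !(stepE mk _ jk rj) (le_trans (B rI j jk _))//.
  have /= := rn (Ordinal (ltnW jk : (j < k.+1)%N)); move/andP: rj => [jr ->].
  by rewrite andbT lt_neqAle jr andbT eq_sym.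
by rewrite lerD2l ler_norm.
Unshelve. all: by end_near. Qed.

End mesh_sequence.
End mesh_functions_seq.

(** * Uniform continuity, bounded variation, discrete Gronwall inequality *)

Section tools.
Context {R : realType}.
Notation mu := (@lebesgue_measure R).

Lemma unif_cont (V : normedModType R) (T : R) (f : R -> V) : continuous f ->
  forall e, 0 < e -> exists2 d, 0 < d & forall s r, s \in `[0, T] ->
    r \in `[0, T] -> `|s - r| < d -> `|f s - f r| <= e.
Proof.
move=> cf e e0.
have H (x : R) : `[0, T]%classic x -> \forall x' \near x & d \near (0:R)^'+,
    forall y, `|x' - y| < d -> `|f x' - f y| <= e.
  move=> _; have e2 : 0 < e / 2 by rewrite divr_gt0.
  have /cvgrPdist_lt /(_ _ e2) := cf x; rewrite nearE => -[n /= n0 Hn].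
  have n2 : 0 < n / 2 by rewrite divr_gt0.
  exists (ball x (n / 2), [set d | d < n / 2]) => /=.
    split; first exact: nbhsx_ballx.
    exact: nbhs_right_lt.
  move=> [x' d] /= [xx' dn] y xy; rewrite /ball/= in xx'.
  have a : `|f x - f x'| < e / 2.
    by apply: Hn; rewrite /= (lt_trans xx')// ltr_pdivrMr// ltr_pMr// ltr1n.
  have b : `|f x - f y| < e / 2.
    apply: Hn => /=; rewrite -(subrKA x') (le_lt_trans (ler_normD _ _))//.
    by rewrite [ltRHS]splitr ltrD// (lt_trans xy).
  rewrite -(subrKA (f x)) (le_trans (ler_normD _ _))// [leRHS]splitr lerD// ltW//.
  by rewrite distrC.
have nc := (compact_near_coveringP _).1 (@segment_compact R 0 T) R (0:R)^'+
  (fun d x' => forall y, `|x' - y| < d -> `|f x' - f y| <= e) _ H.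
have [d [d0 Hd]] := filter_ex (filterI (@nbhs_right_gt R 0) (nc _)).
by exists d => // s r sT _; exact: Hd.
Qed.

Lemma coord_le_norm p (v : 'rV[R]_p) i : `|v 0 i| <= `|v|.
Proof.
rewrite [leRHS]/Num.Def.normr/= mx_normrE.
exact: (le_bigmax _ _ (0, i)).
Qed.

Lemma norm_le_coord p (v : 'rV[R]_p) B : 0 <= B ->
  (forall i, `|v 0 i| <= B) -> `|v| <= B.
Proof.
move=> B0 vB; rewrite [leLHS]/Num.Def.normr/= mx_normrE.
by apply/bigmax_leP; split => // -[i j] _; rewrite (ord1 i)/=.
Qed.

Lemma norm_le_enorm p (v : 'rV[R]_p) : `|v| <= enorm v.
Proof.
apply: norm_le_coord; first exact: sqrtr_ge0.
move=> i; rewrite -(ler_pXn2r (n := 2)) ?nnegrE ?sqrtr_ge0//.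
by rewrite real_normK ?num_real// coord_sqr_le_enorm.
Qed.

Lemma enorm_le_norm p (v : 'rV[R]_p) : enorm v <= p%:R * `|v|.
Proof.
rewrite -(ler_pXn2r (n := 2)) ?nnegrE ?sqrtr_ge0 ?mulr_ge0//.
rewrite enorm_sqr (@le_trans _ _ (\sum_(i < p) `|v| ^+ 2))//.
  apply: ler_sum => i _; rewrite -real_normK ?num_real//.
  by rewrite lerXn2r ?nnegrE// coord_le_norm.
rewrite sumr_const card_ord -[_ *+ p]mulr_natl exprMn.
apply: ler_wpM2r; first exact: sqr_ge0.
by rewrite -natrX ler_nat; case: (p) => // q; rewrite expnS expn1 leq_pmull.
Qed.

(** A property that holds almost everywhere holds somewhere in every
    interval. *)
Lemma ae_pick (P : R -> Prop) (a b : R) : a < b ->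
  {ae mu, forall r : R, P r} -> exists2 r, a < r < b & P r.
Proof.
move=> ab [N [mN N0 PN]]; apply: contrapT => H.
have sub : `]a, b[ `<=` N.
  move=> r; rewrite /= in_itv/= => rab; apply: PN => /= Pr; apply: H.
  by exists r.
have : (mu `]a, b[%classic <= mu N)%E by apply: le_measure => //; rewrite inE.
rewrite N0 /= lebesgue_measure_itv/= lte_fin ab -EFinB lee_fin subr_le0.
by rewrite leNgt ab.
Qed.

(** [G] is the sum of the variation functions of the coordinates. *)
Lemma bv_majorant p (T m : R) (w : R -> 'rV[R]_p) : 0 < T ->
  (vtotal_variation 0%R T w <= m%:E)%E ->
  exists G : R -> R, (forall a b, 0 <= a -> a <= b -> b <= T -> G a <= G b) /\
   forall s r a b, 0 <= a -> b <= T -> a <= s <= b -> a <= r <= b ->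
    `|w s - w r| <= G b - G a.
Proof.
move=> T0 wm.
have bv i : bounded_variation 0 T (fun t => w t 0 i).
  exists m => _ [s sp <-].
  rewrite -lee_fin; apply: le_trans wm.
  apply: (@le_trans _ _ (vvariation 0 T w s)%:E); last first.
    by apply: ereal_sup_ubound; exists s.
  rewrite lee_fin /variation /vvariation; apply: ler_sum => j _ /=.
  apply: le_trans (norm_le_enorm _).
  by apply: le_trans (coord_le_norm _ i); rewrite !mxE.
pose g i (b : R) := fine (total_variation 0 b (fun t => w t 0 i)).
have gD i a b : 0 <= a -> a <= b -> b <= T ->
    total_variation a b (fun t => w t 0 i) = (g i b - g i a)%:E.
  move=> a0 ab bT.
  have b0 : 0 <= b by exact: le_trans ab.
  have fb := (bounded_variationP _ b0).1 (bounded_variationl b0 bT (bv i)).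
  have fa := (bounded_variationP _ a0).1
    (bounded_variationl a0 ab (bounded_variationl b0 bT (bv i))).
  have fab := (bounded_variationP _ ab).1
    (bounded_variationr a0 ab (bounded_variationl b0 bT (bv i))).
  have := @total_variationD R 0 b a (fun t => w t 0 i) a0 ab.
  rewrite /g => E; rewrite [in RHS]E fineD// [fine _ + fine _]addrC addrK fineK//.
have gm i a b : 0 <= a -> a <= b -> b <= T -> g i a <= g i b.
  move=> a0 ab bT; rewrite -subr_ge0 -lee_fin -gD//.
  exact: total_variation_ge0.
have gw i a b : 0 <= a -> a <= b -> b <= T -> `|w b 0 i - w a 0 i| <= g i b - g i a.
  move=> a0 ab bT; rewrite -lee_fin -gD//.
  exact: (@total_variation_ge R _ _ (fun t => w t 0 i)).
exists (fun b => \sum_(i < p) g i b); split.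
  by move=> a b a0 ab bT; apply: ler_sum => i _; exact: gm.
move=> s r a b a0 bT; wlog sr : s r / s <= r.
  move=> H sab rab; have [sr|/ltW rs] := leP s r; first exact: H.
  by rewrite distrC; exact: H.
move=> /andP[as_ sb] /andP[ar rb].
have ab : a <= b by exact: le_trans sb.
have nn i : 0 <= g i b - g i a by rewrite subr_ge0; apply: gm.
rewrite -sumrB; apply: norm_le_coord; first exact: sumr_ge0.
move=> i; rewrite !mxE distrC; apply: (@le_trans _ _ (g i b - g i a)).
  have s0 : 0 <= s by exact: le_trans as_.
  have rT : r <= T by exact: le_trans rb _.
  apply: le_trans (gw i s r s0 sr rT) _; apply: lerB; apply: gm => //.
  - exact: le_trans s0 sr.
  - exact: le_trans sr rT.
by rewrite (bigD1 i)//= lerDl sumr_ge0.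
Qed.

Lemma W12_integrable (T : R) p (z : R -> 'rV[R]_p) i : 0 <= T -> W12 T z ->
  mu.-integrable `[0, T] (EFin \o (fun r => derive1 z r 0 i)).
Proof.
move=> T0 Wz; have [dz mz _ _] := Wz.
apply: (@integrable_ae_eq R T _ _ _ _ (sW12_integrable (W12_coord i T0 Wz))) => //.
by apply: ae_mono dz => r /[apply] dz; rewrite !derive1E derive_mx// mxE.
Qed.

(** Increment over a cell of an arc whose velocity is close to [c] there. *)
Lemma W12_incr (T : R) k (t : nat -> R) p (z : R -> 'rV[R]_p) j (c : 'rV[R]_p) B :
  (0 < k)%N -> is_mesh T k t -> W12 T z -> (j < k)%N -> 0 <= B ->
  {ae mu, forall r : R, r \in `[0, T] -> t j < r < t j.+1 ->
     `|derive1 z r - c| <= B} ->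
  `|z (t j.+1) - z (t j) - (t j.+1 - t j) *: c| <= (t j.+1 - t j) * B.
Proof.
move=> k0 mk Wz jk B0 H; have T0 := ltW (mesh_T0 k0 mk).
have h0 := mesh_h mk jk.
apply: norm_le_coord; first by rewrite mulr_ge0// ltW.
move=> i; have [dz mz _ rep] := Wz; have iz := W12_integrable i T0 Wz.
have ij := integrable_mesh mk jk iz.
have mj : measurable (`[t j, t j.+1] : set R) by [].
have ic (a : R) : mu.-integrable `[t j, t j.+1] (EFin \o cst a).
  exact: integrable_cst_itv.
have E : (z (t j.+1) - z (t j) - (t j.+1 - t j) *: c) 0 i =
    \int[mu]_(r in `[t j, t j.+1]) (derive1 z r 0 i - c 0 i).
  rewrite (@RintegralB _ _ _ mu _ _ (cst (c 0 i)))//= (Rintegral_mesh_cst mk)//.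
  rewrite !mxE (rep (t j.+1)) ?(mesh_itv mk)//.
  rewrite (rep (t j)) ?(mesh_itv mk)//; last exact: ltnW.
  rewrite (@Rintegral_itv_split _ T _ (t j) (t j.+1)).
  - by ring.
  - by rewrite (mesh_ge0 mk)// ltnW.
  - exact: (mesh_le mk).
  - exact: (mesh_leT mk).
  - exact: iz.
have iB : mu.-integrable `[t j, t j.+1]
    (EFin \o (fun r => derive1 z r 0 i - c 0 i)).
  exact: (integrableB _ ij (ic (c 0 i))).
rewrite E; apply: le_trans (le_normr_Rintegral _ iB) _; first exact: measurable_itv.
have iN : mu.-integrable `[t j, t j.+1]
    (EFin \o (fun r => `|derive1 z r 0 i - c 0 i|)) by exact: integrable_norm.
have mN : measurable_fun `[t j, t j.+1] (fun r => `|derive1 z r 0 i - c 0 i|).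
  by apply/measurable_EFinP; case/integrableP : iN.
have mM : measurable_fun `[t j, t j.+1]
    (fun r => Num.min `|derive1 z r 0 i - c 0 i| B).
  exact: measurable_minr.
have s r : t j <= r <= t j.+1 -> r \in `[0, T].
  move=> /andP[a b]; rewrite in_itv/= (le_trans (mesh_ge0 mk (ltnW jk)) a)/=.
  by rewrite (le_trans b)// (mesh_leT mk).
have -> : \int[mu]_(r in `[t j, t j.+1]) `|derive1 z r 0 i - c 0 i| =
    \int[mu]_(r in `[t j, t j.+1]) Num.min `|derive1 z r 0 i - c 0 i| B.
  congr fine; apply: ae_eq_integral => //;
    [exact/measurable_EFinP|exact/measurable_EFinP|].
  apply: ae_mono (ae_and H (ae_and (ae_neq (t j)) (ae_neq (t j.+1)))) => r [H' [n1 n2]].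
  rewrite /= in_itv/= => /andP[a b]; congr EFin; apply/esym/min_idPl.
  have := H' (s r _); rewrite a b => /(_ isT).
  rewrite !lt_neqAle a b n2 eq_sym n1 => /(_ isT).
  by apply: le_trans; have := coord_le_norm (derive1 z r - c) i; rewrite !mxE.
rewrite mulrC -(Rintegral_mesh_cst mk B jk); apply: le_Rintegral => //.
- apply: (le_integrable _ _ _ iN) => //; first exact/measurable_EFinP.
  move=> r _ /=; rewrite lee_fin [leRHS]ger0_norm// ger0_norm ?le_min ?normr_ge0//.
  by rewrite ge_min lexx.
- exact: ic.
- by move=> r _; rewrite ge_min lexx orbT.
Qed.

(** The factor 1 + C h_j is bounded by the exponential of C h_j. *)
Lemma discrete_gronwall (C : R) (k : nat) (E h dl : nat -> R) : 0 <= C ->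
  E 0%N <= 0 -> (forall j, (j < k)%N -> 0 <= h j) ->
  (forall j, (j < k)%N -> 0 <= dl j) ->
  (forall j, (j < k)%N -> E j.+1 <= (1 + C * h j) * E j + dl j) ->
  forall j, (j <= k)%N ->
    E j <= expR (C * \sum_(i < j) h i) * \sum_(i < j) dl i.
Proof.
move=> C0 E0 h0 dl0 H; elim=> [|j IH] jk; first by rewrite !big_ord0 !mulr0.
have hj := h0 j jk; have dj := dl0 j jk.
have Ch : 0 <= C * h j by rewrite mulr_ge0.
have sh : 0 <= \sum_(i < j) h i.
  by apply: sumr_ge0 => i _; apply: h0; exact: ltn_trans jk.
have sd : 0 <= \sum_(i < j) dl i.
  by apply: sumr_ge0 => i _; apply: dl0; exact: ltn_trans jk.
apply: (le_trans (H j jk)); rewrite !big_ord_recr/= [C * (_ + _)]mulrDr expRD.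
apply: (@le_trans _ _ (expR (C * h j) *
  (expR (C * \sum_(i < j) h i) * \sum_(i < j) dl i) + dl j)).
  rewrite lerD2r; apply: (@le_trans _ _ ((1 + C * h j) *
    (expR (C * \sum_(i < j) h i) * \sum_(i < j) dl i))).
    by rewrite ler_wpM2l ?addr_ge0// IH// ltnW.
  by rewrite ler_wpM2r ?expR_ge1Dx// mulr_ge0 ?expR_ge0.
rewrite mulrDr mulrA [_ * expR (C * \sum_(i < j) h i)]mulrC lerD2l ler_peMl//.
by rewrite -expRD -expR0 ler_expR addr_ge0// mulr_ge0.
Qed.

End tools.

(** * Error estimate on one mesh *)

Section discrete_estimate.
Context {R : realType}.
Notation mu := (@lebesgue_measure R).
(** [X] and [Y] are discrete arcs on the mesh [t] with slopes [v] and [w], to be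
    compared with [xb] and [yb].  [F1 r] and [F2 r] stand for f1 (ab r, .) and
    f2 (bb r, .); [q j] is an approximation of the velocity of [xb] on the [j]-th
    cell, with error [D j], and [q j + phi (tau j)] is the opposite of the normal
    vector used at step [j]. *)
Variables (n k : nat) (T : R) (t : nat -> R).
Variables (F1 F2 : R -> 'rV[R]_n -> 'rV[R]_n) (xb yb : R -> 'rV[R]_n).
Variables (tau D : nat -> R) (q X Y v w : nat -> 'rV[R]_n) (L r1 eps K : R).
Let phi r := F1 r (xb r) + yb r.
Let psi r := F2 r (xb r).
Hypotheses (k0 : (0 < k)%N) (mesh : is_mesh T k t).
Hypotheses (Wx : W12 T xb) (Wy : W12 T yb) (L0 : 0 <= L) (eps0 : 0 <= eps).
Hypothesis dy : {ae mu, forall r : R, r \in `[0, T] -> derive1 yb r = psi r}.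
Hypothesis lip : forall r x x', r \in `[0, T] -> `|x| <= r1 -> `|x'| <= r1 ->
  `|F1 r x - F1 r x'| <= L * `|x - x'| /\ `|F2 r x - F2 r x'| <= L * `|x - x'|.
Hypothesis xb_r1 : forall r, r \in `[0, T] -> `|xb r| + 1 <= r1.
Hypothesis modulus : forall j r, (j < k)%N -> t j <= r <= t j.+1 ->
  [/\ `|phi r - phi (t j)| <= eps, `|psi r - psi (t j)| <= eps
    & `|yb r - yb (t j)| <= eps].
Hypothesis tauP : forall j, (j < k)%N -> t j <= tau j <= t j.+1.
Hypothesis qD : {ae mu, forall r : R, r \in `[0, T] -> forall j, (j < k)%N ->
  t j < r < t j.+1 -> `|q j - derive1 xb r| <= D j}.
Hypothesis D0 : forall j, (j < k)%N -> 0 <= D j.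
Hypothesis DK : \sum_(j < k) D j <= K.
Hypotheses (X0 : X 0%N = xb 0) (Y0 : Y 0%N = yb 0).
Hypothesis XS : forall j, (j < k)%N -> X j.+1 = X j + (t j.+1 - t j) *: v j.
Hypothesis YS : forall j, (j < k)%N -> Y j.+1 = Y j + (t j.+1 - t j) *: w j.
Hypothesis vE : forall j, (j < k)%N ->
  v j = q j + phi (tau j) - F1 (t j) (X j) - Y j.+1.
Hypothesis wE : forall j, (j < k)%N -> w j = F2 (t j) (X j).

(* C is the growth rate of e + d found in E_step, where d j.+1 is eliminated
   by d_step; the two terms of S sum the contributions of D and of eps *)
Let C := 2 * L + 1 + L * T.
Let S := expR (C * T) * (T / k%:R * K + T * ((3 + T) * eps)).
Hypothesis S1 : S <= 1.
Let e j := `|X j - xb (t j)|.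
Let d j := `|Y j - yb (t j)|.

Let e_ge0 j : 0 <= e j. Proof. exact: normr_ge0. Qed.

Let d_ge0 j : 0 <= d j. Proof. exact: normr_ge0. Qed.

Let T0 : 0 < T. Proof. exact: mesh_T0 k0 mesh. Qed.

Let tj j : (j < k)%N -> t j \in `[0, T].
Proof. by move=> jk; apply: (mesh_itv mesh); exact: ltnW. Qed.

Let xb_le j : (j < k)%N -> `|xb (t j)| <= r1.
Proof. by move=> jk; have := xb_r1 (tj jk); lra. Qed.

Lemma w_bound j : (j < k)%N -> `|X j| <= r1 ->
  {ae mu, forall r : R, r \in `[0, T] -> t j < r < t j.+1 ->
    `|w j - derive1 yb r| <= L * e j + eps}.
Proof.
move=> jk Xr; apply: ae_mono dy => r dyr rT /andP[jr rj].
rewrite dyr// wE// -(subrKA (psi (t j))) (le_trans (ler_normD _ _))// lerD//.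
  by case: (lip (tj jk) Xr (xb_le jk)).
by rewrite distrC; case: (@modulus j r jk) => //; rewrite !ltW.
Qed.

(** [d j.+1] rather than [d j] appears because the discrete inclusion
    takes [y] at the right end point of the cell. *)
Lemma v_bound j : (j < k)%N -> `|X j| <= r1 ->
  {ae mu, forall r : R, r \in `[0, T] -> t j < r < t j.+1 ->
    `|v j - derive1 xb r| <= D j + (2 * eps + L * e j + d j.+1)}.
Proof.
move=> jk Xr; apply: ae_mono qD => r H rT jrj; have {}H := H rT j jk jrj.
have [m1 _ _] := modulus jk (tauP jk).
have [_ _ m2] : [/\ `|phi (t j.+1) - phi (t j)| <= eps,
    `|psi (t j.+1) - psi (t j)| <= eps & `|yb (t j.+1) - yb (t j)| <= eps].
  by apply: modulus => //; rewrite lexx andbT (mesh_le mesh).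
have [l1 _] := lip (tj jk) (xb_le jk) Xr.
rewrite vE//.
have -> : q j + phi (tau j) - F1 (t j) (X j) - Y j.+1 - derive1 xb r =
   (q j - derive1 xb r) + ((phi (tau j) - phi (t j)) +
   ((F1 (t j) (xb (t j)) - F1 (t j) (X j)) +
   (- (yb (t j.+1) - yb (t j)) - (Y j.+1 - yb (t j.+1))))).
  by rewrite [phi (t j)]/phi; apply/matrixP => a b; rewrite !mxE; ring.
rewrite (le_trans (ler_normD _ _))// lerD//.
rewrite (le_trans (ler_normD _ _))//.
have N1 := ler_normD (F1 (t j) (xb (t j)) - F1 (t j) (X j))
   (- (yb (t j.+1) - yb (t j)) - (Y j.+1 - yb (t j.+1))).
have N2 := ler_normB (- (yb (t j.+1) - yb (t j))) (Y j.+1 - yb (t j.+1)).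
rewrite normrN in N2; rewrite [X in L * X]distrC -/(e j) in l1.
rewrite -/(d j.+1) in N2; lra.
Qed.

Lemma d_step j : (j < k)%N -> `|X j| <= r1 ->
  d j.+1 <= d j + (t j.+1 - t j) * (L * e j + eps).
Proof.
move=> jk Xr; have h0 := mesh_h mesh jk.
have B0 : 0 <= L * e j + eps by rewrite addr_ge0// mulr_ge0// e_ge0.
have H : `|yb (t j.+1) - yb (t j) - (t j.+1 - t j) *: w j| <=
    (t j.+1 - t j) * (L * e j + eps).
  apply: (W12_incr k0 mesh Wy jk B0).
  by apply: ae_mono (w_bound jk Xr) => r H rT jrj; rewrite distrC; exact: H.
rewrite /d YS//.
have -> : Y j + (t j.+1 - t j) *: w j - yb (t j.+1) = (Y j - yb (t j)) -
   (yb (t j.+1) - yb (t j) - (t j.+1 - t j) *: w j).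
  by apply/matrixP => a b; rewrite !mxE; ring.
by rewrite (le_trans (ler_normB _ _))// lerD2l.
Qed.

Lemma e_step j : (j < k)%N -> `|X j| <= r1 ->
  e j.+1 <= e j + (t j.+1 - t j) * (D j + (2 * eps + L * e j + d j.+1)).
Proof.
move=> jk Xr; have h0 := mesh_h mesh jk.
have B0 : 0 <= D j + (2 * eps + L * e j + d j.+1).
  by rewrite !addr_ge0 ?mulr_ge0 ?d_ge0 ?e_ge0 ?D0.
have H : `|xb (t j.+1) - xb (t j) - (t j.+1 - t j) *: v j| <=
    (t j.+1 - t j) * (D j + (2 * eps + L * e j + d j.+1)).
  apply: (W12_incr k0 mesh Wx jk B0).
  by apply: ae_mono (v_bound jk Xr) => r H rT jrj; rewrite distrC; exact: H.
rewrite /e XS//.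
have -> : X j + (t j.+1 - t j) *: v j - xb (t j.+1) = (X j - xb (t j)) -
   (xb (t j.+1) - xb (t j) - (t j.+1 - t j) *: v j).
  by apply/matrixP => a b; rewrite !mxE; ring.
by rewrite (le_trans (ler_normB _ _))// lerD2l.
Qed.

Let dl j := (t j.+1 - t j) * D j + (t j.+1 - t j) * ((3 + T) * eps).

Let dl_ge0 j : (j < k)%N -> 0 <= dl j.
Proof.
move=> jk; have h0 := ltW (mesh_h mesh jk).
by rewrite addr_ge0// mulr_ge0 ?D0// mulr_ge0// addr_ge0// ltW.
Qed.

Lemma E_step j : (j < k)%N -> `|X j| <= r1 ->
  e j.+1 + d j.+1 <= (1 + C * (t j.+1 - t j)) * (e j + d j) + dl j.
Proof.
move=> jk Xr; have h0 := mesh_h mesh jk.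
have hT : t j.+1 - t j <= T.
  have := mesh_leT mesh jk; have := mesh_ge0 mesh (ltnW jk); lra.
have He := e_step jk Xr; have Hd := d_step jk Xr.
have e0 : 0 <= e j by exact: normr_ge0.
have d0 : 0 <= d j by exact: normr_ge0.
have d1 : d j.+1 <= (1 + L * T) * (e j + d j) + T * eps.
  apply: (le_trans Hd).
  have : (t j.+1 - t j) * (L * e j + eps) <= T * (L * e j + eps).
    by rewrite ler_wpM2r// addr_ge0// mulr_ge0.
  have : 0 <= L * T * d j by rewrite !mulr_ge0// ltW.
  lra.
have He' : e j.+1 <= e j + (t j.+1 - t j) * (D j + (2 * eps + L * e j +
    ((1 + L * T) * (e j + d j) + T * eps))).
  by apply: (le_trans He); rewrite lerD2l ler_wpM2l ?(ltW h0)// !lerD2l.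
apply: (le_trans (lerD He' Hd)); rewrite /dl /C.
have : 0 <= (t j.+1 - t j) * (L * d j) by rewrite !mulr_ge0// ltW.
have : 0 <= (t j.+1 - t j) * (L * e j) by rewrite !mulr_ge0// ltW.
lra.
Qed.

Let sum_h j : (j <= k)%N -> \sum_(i < j) (t i.+1 - t i) <= T.
Proof.
move=> jk; rewrite -(big_mkord xpredT (fun i => t i.+1 - t i)) telescope_sumr//.
by have [-> _ _] := mesh; rewrite subr0 (mesh_leT mesh).
Qed.

Let sum_dl j : (j <= k)%N ->
  \sum_(i < j) dl i <= T / k%:R * K + T * ((3 + T) * eps).
Proof.
move=> jk; rewrite big_split/= lerD//; last first.
  rewrite -mulr_suml ler_wpM2r ?sum_h// mulr_ge0// addr_ge0// ltW//.
apply: (@le_trans _ _ (\sum_(i < j) (T / k%:R) * D i)).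
  apply: ler_sum => i _; have ik : (i < k)%N by exact: leq_trans jk.
  by rewrite ler_wpM2r ?D0//; have [_ _ /(_ i ik)[]] := mesh.
rewrite -mulr_sumr ler_wpM2l ?divr_ge0// ?(ltW T0)//; apply: le_trans DK.
rewrite -(big_mkord xpredT D) -(big_mkord xpredT D).
rewrite (big_cat_nat (n := j) (p := k))//= lerDl big_nat_cond sumr_ge0// => i.
by rewrite andbT => /andP[_ ik]; exact: D0.
Qed.

Let C0 : 0 <= C.
Proof. by rewrite /C !addr_ge0// mulr_ge0// ltW. Qed.

(** The Lipschitz constants are only valid in the ball of radius [r1]; as
    long as the first [m] points stay there, the error is at most [S] up
    to time [m]. *)
Lemma gronwall_upto m : (m <= k)%N -> (forall j, (j < m)%N -> `|X j| <= r1) ->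
  forall j, (j <= m)%N -> e j + d j <= S.
Proof.
move=> mk Xr j jm; have jk := leq_trans jm mk.
apply: (le_trans (@discrete_gronwall R C m (fun j => e j + d j)
  (fun j => t j.+1 - t j) dl C0 _ _ _ _ j jm)).
- have [t0 _ _] := mesh.
  by rewrite /e /d t0 X0 Y0 !subrr normr0 addr0.
- by move=> i im; apply/ltW/(mesh_h mesh); exact: leq_trans mk.
- move=> i im; have ik := leq_trans im mk.
  exact: dl_ge0.
- by move=> i im; apply: E_step; [exact: leq_trans mk|exact: Xr].
have s0 i : (i <= k)%N -> 0 <= \sum_(j < i) dl j.
  move=> ik; apply: sumr_ge0 => a _; have ak : (a < k)%N by exact: leq_trans ik.
  exact: dl_ge0.
apply: ler_pM; rewrite ?expR_ge0 ?s0 ?sum_dl// ler_expR ler_wpM2l//.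
exact: sum_h.
Qed.

(** Since [S <= 1] and [xb] stays in the ball of radius [r1 - 1], the
    discrete state never leaves the ball of radius [r1]. *)
Lemma E_bound j : (j <= k)%N -> e j + d j <= S.
Proof.
suff : forall m, (m <= k)%N -> forall j, (j <= m)%N -> e j + d j <= S.
  by move=> H jk; exact: (H k).
elim=> [|m IH] mk; first by apply: gronwall_upto.
apply: gronwall_upto => // i; rewrite ltnS => im.
have ik : (i < k)%N by exact: leq_ltn_trans mk.
have := IH (ltnW mk) i im; have := xb_r1 (tj ik).
have d0 : 0 <= d i by exact: normr_ge0.
have := ler_normD (X i - xb (t i)) (xb (t i)); rewrite subrK -/(e i).
move: S1; lra.
Qed.

Let X_le j : (j < k)%N -> `|X j| <= r1.
Proof.
move=> jk; have := E_bound (ltnW jk); have := xb_r1 (tj jk).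
have d0 : 0 <= d j by exact: normr_ge0.
have := ler_normD (X j - xb (t j)) (xb (t j)); rewrite subrK -/(e j).
move: S1; lra.
Qed.

Lemma v_close j : (j < k)%N ->
  {ae mu, forall r : R, r \in `[0, T] -> t j < r < t j.+1 ->
    `|v j - derive1 xb r| <= (2 * eps + (L + 1) * S) + D j}.
Proof.
move=> jk; apply: ae_mono (v_bound jk (X_le jk)) => r H rT jrj.
apply: (le_trans (H rT jrj)).
have E1 := E_bound (ltnW jk); have E2 := E_bound jk.
have d0 : 0 <= d j by exact: normr_ge0.
have e1 : 0 <= e j.+1 by exact: normr_ge0.
have : L * e j <= L * S by rewrite ler_wpM2l//; lra.
lra.
Qed.

Lemma w_close j : (j < k)%N ->
  {ae mu, forall r : R, r \in `[0, T] -> t j < r < t j.+1 ->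
    `|w j - derive1 yb r| <= 2 * eps + (L + 1) * S}.
Proof.
move=> jk; apply: ae_mono (w_bound jk (X_le jk)) => r H rT jrj.
apply: (le_trans (H rT jrj)).
have E1 := E_bound (ltnW jk).
have d0 : 0 <= d j by exact: normr_ge0.
have e1 : 0 <= e j by exact: normr_ge0.
have : L * e j <= L * S by rewrite ler_wpM2l//; lra.
move: eps0; lra.
Qed.

Lemma vw_close : {ae mu, forall r : R, r \in `[0, T] -> forall j, (j < k)%N ->
  t j < r < t j.+1 ->
  `|v j - derive1 xb r| <= (2 * eps + (L + 1) * S) + D j /\
  `|w j - derive1 yb r| <= 2 * eps + (L + 1) * S}.
Proof.
have H := ae_and (ae_forall (fun j : 'I_k => v_close (ltn_ord j)))
  (ae_forall (fun j : 'I_k => w_close (ltn_ord j))).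
apply: ae_mono H => r [Hv Hw] rT j jk jrj.
by split; [exact: (Hv (Ordinal jk))|exact: (Hw (Ordinal jk))].
Qed.

End discrete_estimate.

(** * Normal cones of translates *)

Section normal_cone_facts.
Context {R : realType}.

(** The constant sequences are admissible in the definition of the cone. *)
Lemma normal_cone0 n (Om : set 'rV[R]_n) x : Om x -> normal_cone Om x 0.
Proof.
move=> Ox; split=> //; exists (fun=> x), (fun=> x), (fun=> 0); split => //.
- exact: cvg_cst.
- move=> _; split => // z _; rewrite subrr /enorm big1 ?sqrtr0 ?sqrtr_ge0// => i _.
  by rewrite mxE expr0n.
- by under eq_fun do rewrite scale0r; exact: cvg_cst.
Qed.

Lemma Cmov_shift n s (g : 'I_s -> 'rV[R]_n -> R) u e x :
  Cmov g u x -> Cmov g (u + e) (x + e).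
Proof. by move=> [z Cz <-]; exists z => //; rewrite addrA. Qed.

Lemma normal_cone_shift n s (g : 'I_s -> 'rV[R]_n -> R) u e x v :
  normal_cone (Cmov g u) x v -> normal_cone (Cmov g (u + e)) (x + e) v.
Proof.
move=> [Cx [xk [wk [al [cx pw al0 cv]]]]]; split; first exact: Cmov_shift.
exists (fun k => xk k + e), (fun k => wk k + e), al; split => //.
- by apply: cvgD => //; exact: cvg_cst.
- move=> k; have [Cw H] := pw k; split; first exact: Cmov_shift.
  move=> z Cz; rewrite opprD addrACA subrr addr0.
  have Cz' : Cmov g u (z - e) by have := Cmov_shift (- e) Cz; rewrite addrK.
  by apply: (le_trans (H _ Cz')); rewrite opprB addrA addrAC.
- by under eq_fun do rewrite opprD addrACA subrr addr0.
Qed.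

End normal_cone_facts.

(** * Vector-valued arcs and interpolants *)

Section blocks.
Context {R : realType}.

Lemma continuous_pair_comp (U V W X : topologicalType) (f : U -> V -> W)
    (a : X -> U) (b : X -> V) : continuous (fun p : U * V => f p.1 p.2) ->
  continuous a -> continuous b -> continuous (fun x => f (a x) (b x)).
Proof.
move=> cf ca cb x; apply: (@continuous2_cvg _ _ _ _ _ _ a b f (a x) (b x)).
- exact: (cf (a x, b x)).
- exact: ca.
- exact: cb.
Qed.

Lemma W12_row_mx (T : R) p1 p2 (z1 : R -> 'rV[R]_p1) (z2 : R -> 'rV[R]_p2) :
  0 <= T -> W12 T z1 -> W12 T z2 -> W12 T (fun t => row_mx (z1 t) (z2 t)).
Proof.
move=> T0 W1 W2; apply: W12_of_coord => // i; case: (split_ordP i) => j ->.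
  have := W12_coord j T0 W1; congr sW12; apply/funext => t.
  by rewrite row_mxEl.
have := W12_coord j T0 W2; congr sW12; apply/funext => t.
by rewrite row_mxEr.
Qed.

Lemma W12_row_mxl (T : R) p1 p2 (z1 : R -> 'rV[R]_p1) (z2 : R -> 'rV[R]_p2) :
  0 <= T -> W12 T (fun t => row_mx (z1 t) (z2 t)) -> W12 T z1.
Proof.
move=> T0 W; apply: W12_of_coord => // i; have := W12_coord (lshift p2 i) T0 W.
by congr sW12; apply/funext => t; rewrite row_mxEl.
Qed.

Lemma W12_row_mxr (T : R) p1 p2 (z1 : R -> 'rV[R]_p1) (z2 : R -> 'rV[R]_p2) :
  0 <= T -> W12 T (fun t => row_mx (z1 t) (z2 t)) -> W12 T z2.
Proof.
move=> T0 W; apply: W12_of_coord => // i; have := W12_coord (rshift p1 i) T0 W.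
by congr sW12; apply/funext => t; rewrite row_mxEr.
Qed.

Lemma eq_seq_cvg (u v : nat -> R) (l : R) : u =1 v ->
  u k @[k --> \oo] --> l -> v k @[k --> \oo] --> l.
Proof. by move=> /funext ->. Qed.

Lemma eq_veldist (T : R) (f f' g g' : R -> R) : f =1 f' -> g =1 g' ->
  veldist T f g = veldist T f' g'.
Proof. by move=> /funext -> /funext ->. Qed.

(** Coordinatewise L2 convergence of the velocities. *)
Definition veldist_cvg (T : R) p (z_ : nat -> R -> 'rV[R]_p) (z : R -> 'rV[R]_p) :=
  forall i, veldist T (fun t => z_ k t 0 i) (fun t => z t 0 i) @[k --> \oo] --> 0.

Lemma veldist_cvg_row_mx (T : R) p1 p2 (z1_ : nat -> R -> 'rV[R]_p1)
    (z2_ : nat -> R -> 'rV[R]_p2) z1 z2 :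
  veldist_cvg T z1_ z1 -> veldist_cvg T z2_ z2 ->
  veldist_cvg T (fun k t => row_mx (z1_ k t) (z2_ k t)) (fun t => row_mx (z1 t) (z2 t)).
Proof.
move=> c1 c2 i; case: (split_ordP i) => j ->.
  apply: eq_seq_cvg (c1 j) => k.
  by apply: eq_veldist => t; rewrite row_mxEl.
apply: eq_seq_cvg (c2 j) => k.
by apply: eq_veldist => t; rewrite row_mxEr.
Qed.

Lemma W12_sub (T : R) p (z1 z2 : R -> 'rV[R]_p) : 0 <= T ->
  W12 T z1 -> W12 T z2 -> W12 T (fun t => z1 t - z2 t).
Proof.
move=> T0 W1 W2; apply: W12_of_coord => // i.
have := sW12_sub T0 (W12_coord i T0 W1) (W12_coord i T0 W2).
by congr sW12; apply/funext => t; rewrite !mxE.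
Qed.

Lemma W12_clamp_continuous (T : R) p (z : R -> 'rV[R]_p) : 0 <= T -> W12 T z ->
  continuous (z \o clamp T).
Proof.
move=> T0 W; apply: rV_continuous => i.
exact: (sW12_continuous T0 (W12_coord i T0 W)).
Qed.

Lemma W12_bounded (T : R) p (z : R -> 'rV[R]_p) : 0 <= T -> W12 T z ->
  exists2 B, 0 <= B & forall r, r \in `[0, T] -> `|z r| <= B.
Proof.
move=> T0 W; have c := W12_clamp_continuous T0 W.
have cn : continuous (fun r => `|(z \o clamp T) r|).
  by move=> r; apply: cvg_norm; exact: c.
have [b bT Hb] := EVT_max T0 (continuous_subspaceT cn).
exists `|z b| => // r rT; have := Hb r rT.
by rewrite /= !clamp_id.
Qed.

Lemma plin_W12 (T : R) k (t : nat -> R) p (z0 : 'rV[R]_p) c : (0 < k)%N ->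
  is_mesh T k t -> W12 T (plin k t z0 c).
Proof.
move=> k0 mk; apply: W12_of_coord; first exact: ltW (mesh_T0 k0 mk).
move=> i; have := splin_sW12 k0 mk (z0 0 i) (fun j => c j 0 i).
by congr sW12; apply/funext => r; rewrite plin_coord.
Qed.

Lemma lws_sub k (t : nat -> R) p (z1 z2 : R -> 'rV[R]_p) c1 c2 :
  linear_with_slopes k t z1 c1 -> linear_with_slopes k t z2 c2 ->
  linear_with_slopes k t (fun r => z1 r - z2 r) (fun j => c1 j - c2 j).
Proof.
move=> H1 H2 j jk r rj; rewrite (H1 j jk r rj) (H2 j jk r rj).
by apply/matrixP => a b; rewrite !mxE; ring.
Qed.

(** Slopes of the piecewise linear function with values [z j] at the mesh
    points. *)
Definition slope (t : nat -> R) p (z : nat -> 'rV[R]_p) (j : nat) : 'rV[R]_p :=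
  (t j.+1 - t j)^-1 *: (z j.+1 - z j).

Lemma exists_min_pos (h : nat -> R) k : (forall i, (i < k)%N -> 0 < h i) ->
  exists2 e, 0 < e & forall i, (i < k)%N -> e <= h i.
Proof.
elim: k => [|k IH] h0; first by exists 1.
have [|e e0 eh] := IH; first by move=> i ik; apply: h0; exact: ltnW.
exists (Num.min e (h k)); first by rewrite lt_min e0 h0.
move=> i; rewrite ltnS leq_eqVlt => /predU1P[->|ik].
  by rewrite ge_min lexx orbT.
by rewrite ge_min eh.
Qed.

Lemma interp_cvg (T : R) (t : nat -> nat -> R) p (z : R -> 'rV[R]_p) : 0 < T ->
  (forall k, (0 < k)%N -> is_mesh T k (t k)) -> W12 T z ->
  veldist_cvg T (fun k => plin k (t k) (z 0) (slope (t k) (z \o t k))) z.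
Proof.
move=> T0 mesh W i; have Wi := W12_coord i (ltW T0) W.
apply: eq_seq_cvg (mean_vel_cvg mesh (fun=> z 0 0 i) Wi) => k.
apply: eq_veldist => // r; rewrite plin_coord; congr (_ + _).
by apply: eq_bigr => j _; rewrite /slope /mean_vel !mxE.
Qed.

(** The nodal values may differ from those of [z] by a quantity that is
    small compared with every cell of the mesh. *)
Lemma perturbed_interp_cvg (T : R) (t : nat -> nat -> R) p (z : R -> 'rV[R]_p)
    (z_ : nat -> nat -> 'rV[R]_p) : 0 < T ->
  (forall k, (0 < k)%N -> is_mesh T k (t k)) -> W12 T z ->
  (forall k j i, (0 < k)%N -> (j <= k)%N -> (i < k)%N ->
     `|z_ k j - z (t k j)| <= (t k i.+1 - t k i) / k%:R) ->
  veldist_cvg T (fun k => plin k (t k) (z 0) (slope (t k) (z_ k))) z.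
Proof.
move=> T0 mesh W zz i; have Wi := W12_coord i (ltW T0) W.
have c2 : 2 / k%:R @[k --> \oo] --> (0 : R) by apply: cvg_Tk.
have := @veldist_perturb_cvg R T t T0 mesh _ (fun=> z 0 0 i)
  (fun k => mean_vel (t k) (fun t => z t 0 i))
  (fun k j => slope (t k) (z_ k) j 0 i) (fun k => 2 / k%:R) Wi _ c2
  (mean_vel_cvg mesh (fun=> z 0 0 i) Wi).
have Hc k j : (0 < k)%N -> (j < k)%N ->
    `|slope (t k) (z_ k) j 0 i - mean_vel (t k) (fun t => z t 0 i) j| <= 2 / k%:R.
  move=> k0 jk; have mk := mesh k k0; have h0 := mesh_h mk jk.
  have -> : slope (t k) (z_ k) j 0 i - mean_vel (t k) (fun t => z t 0 i) j =
      (t k j.+1 - t k j)^-1 *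
      ((z_ k j.+1 - z (t k j.+1)) - (z_ k j - z (t k j))) 0 i.
    by rewrite /slope /mean_vel !mxE; ring.
  rewrite normrM gtr0_norm ?invr_gt0// ler_pdivrMl//.
  apply: (le_trans (coord_le_norm _ i)); apply: (le_trans (ler_normB _ _)).
  have := zz k j j k0 (ltnW jk) jk; have := zz k j.+1 j k0 jk jk; lra.
move=> H; apply: eq_seq_cvg (H Hc) => k.
by apply: eq_veldist => // r; rewrite plin_coord.
Qed.

(** Semi-implicit Euler scheme: the new value of the second component
    enters the step of the first one. [P j] is the opposite of the normal
    vector used at step [j]. *)
Fixpoint traj n (F1 F2 : nat -> 'rV[R]_n -> 'rV[R]_n) (h : nat -> R)
    (P : nat -> 'rV[R]_n) (x0 : 'rV[R]_n) (j : nat) : 'rV[R]_n * 'rV[R]_n :=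
  if j is j'.+1 then
    let z := traj F1 F2 h P x0 j' in
    let y' := z.2 + h j' *: F2 j' z.1 in
    (z.1 + h j' *: (P j' - F1 j' z.1 - y'), y')
  else (x0, 0).

End blocks.

(** * Choice of the nodes and of the constants *)

Section main_lemmas.
Context {R : realType}.
Notation mu := (@lebesgue_measure R).

(** The nodes [tau k j] lie where [P] holds, except the two end points,
    and [z] hardly changes between [t k j] and [tau k j]. *)
Lemma choose_nodes (T : R) (t : nat -> nat -> R) (P : R -> Prop) n
    (z : R -> 'rV[R]_n) : (forall k, (0 < k)%N -> is_mesh T k (t k)) ->
  {ae mu, forall r : R, P r} -> W12 T z ->
  exists tau : nat -> nat -> R, forall k, (0 < k)%N ->
    [/\ tau k 0%N = 0, tau k k = T,
        forall j, (j < k)%N -> t k j <= tau k j <= t k j.+1,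
        forall j, (0 < j < k)%N -> t k j < tau k j < t k j.+1 /\ P (tau k j)
      & forall j i, (j <= k)%N -> (i < k)%N ->
          `|z (tau k j) - z (t k j)| <= (t k i.+1 - t k i) / k%:R].
Proof.
move=> mesh aeP Wz.
suff : forall k, exists tau : nat -> R, (0 < k)%N ->
    [/\ tau 0%N = 0, tau k = T,
        forall j, (j < k)%N -> t k j <= tau j <= t k j.+1,
        forall j, (0 < j < k)%N -> t k j < tau j < t k j.+1 /\ P (tau j)
      & forall j i, (j <= k)%N -> (i < k)%N ->
          `|z (tau j) - z (t k j)| <= (t k i.+1 - t k i) / k%:R].
  by move=> /choice[tau H]; exists tau.
move=> k; have [->|k0] := posnP k; first by exists (fun=> 0).
have mk := mesh k k0; have [t0 tT _] := mk.
have T0 := ltW (mesh_T0 k0 mk).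
have kR : 0 < k%:R :> R by rewrite ltr0n.
have [|e e0 eh] := @exists_min_pos R (fun i => (t k i.+1 - t k i) / k%:R) k.
  by move=> i ik; rewrite divr_gt0// (mesh_h mk).
have [d d0 Hd] := unif_cont T (W12_clamp_continuous T0 Wz) e0.
have pick j : exists r, (0 < j < k)%N ->
    [/\ t k j < r < t k j.+1, P r & `|z r - z (t k j)| <= e].
  have [/andP[j0 jk]|] := boolP (0 < j < k)%N; last by exists 0.
  have lt1 : t k j < Num.min (t k j.+1) (t k j + d).
    by rewrite lt_min (mesh_lt mk)//= ltrDl.
  have [r /andP[jr rj] Pr] := ae_pick lt1 aeP.
  move: rj; rewrite lt_min => /andP[rj rd].
  exists r => _; split => //; first by rewrite jr.
  have rT : r \in `[0, T].
    rewrite in_itv/= (le_trans (mesh_ge0 mk (ltnW jk)) (ltW jr))/=.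
    by rewrite (le_trans (ltW rj))// (mesh_leT mk).
  have tjT := mesh_itv mk (ltnW jk).
  have := Hd r (t k j) rT tjT; rewrite /= !clamp_id//; apply.
  by rewrite gtr0_norm ?subr_gt0// ltrBlDl.
have [f Hf] := choice pick.
exists (fun j => if j == 0%N then 0 else if (j < k)%N then f j else T) => _.
have kn0 : (k == 0%N) = false by apply/negbTE; rewrite -lt0n.
split => //.
- by rewrite kn0 ltnn.
- move=> j jk; case: eqVneq => [->|j0].
    by rewrite t0 lexx -t0 (mesh_le mk).
  rewrite jk; have [|/andP[jr rj] _ _] := Hf j; first by rewrite lt0n j0.
  by rewrite !ltW.
- move=> j /andP[j0 jk]; rewrite gtn_eqF// jk.
  by have [|? ? _] := Hf j; [rewrite j0|split].
- move=> j i jk ik; apply: le_trans (eh i ik).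
  have [->|j0] := eqVneq j 0%N; first by rewrite t0 subrr normr0 ltW.
  case: ifP => [jk'|jk'].
    by have [|_ _] := Hf j; first by rewrite lt0n j0.
  have -> : j = k by apply/eqP; rewrite eqn_leq jk leqNgt jk'.
  by rewrite tT subrr normr0 ltW.
Qed.

(** Local Lipschitz estimates in the sup norm, with a common constant. *)
Lemma H2_lip n m d s (T : R) (g : 'I_s -> 'rV[R]_n -> R)
    (f1 : 'rV[R]_m -> 'rV[R]_n -> 'rV[R]_n)
    (f2 : 'rV[R]_d -> 'rV[R]_n -> 'rV[R]_n) (a : R -> 'rV[R]_m)
    (b : R -> 'rV[R]_d) (r1 : R) :
  H2 T g f1 f2 -> W12 T (fun t => row_mx (a t) (b t)) -> 0 <= r1 ->
  exists2 L, 0 <= L & forall r x x', r \in `[0, T] -> `|x| <= r1 ->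
    `|x'| <= r1 ->
    `|f1 (a r) x - f1 (a r) x'| <= L * `|x - x'| /\
    `|f2 (b r) x - f2 (b r) x'| <= L * `|x - x'|.
Proof.
move=> [_ _ _ H] W r0.
have re : 0 < n%:R * r1 + 1 by rewrite ltr_wpDl// mulr_ge0.
have [L [L1 [L2 [L0 L10 _ Hl _]]]] := H _ a b re W.
exists ((L + L1) * n%:R); first by rewrite mulr_ge0// addr_ge0.
move=> r x x' rT xr xr'.
have en (y : 'rV[R]_n) : `|y| <= r1 -> enorm y <= n%:R * r1 + 1.
  move=> yr; apply: (le_trans (enorm_le_norm y)).
  by rewrite (le_trans (ler_wpM2l _ yr))// lerDl.
have [H1 H2] := Hl r x x' rT (en _ xr) (en _ xr').
have xx := enorm_le_norm (x - x').
have e0 : 0 <= enorm (x - x') by exact: sqrtr_ge0.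
split; apply: (le_trans (norm_le_enorm _)).
  apply: (le_trans H1); rewrite -mulrA; apply: ler_pM => //.
  by rewrite lerDl.
apply: (le_trans H2); rewrite -mulrA; apply: ler_pM => //.
by rewrite lerDr.
Qed.

(** [S] is the bound of the error estimate [E_bound]. *)
Lemma small_params (T L K e : R) : 0 < T -> 0 <= L -> 0 <= K -> 0 < e ->
  exists2 eps, 0 < eps & \forall k \near \oo,
    let S := expR ((2 * L + 1 + L * T) * T) *
      (T / k%:R * K + T * ((3 + T) * eps)) in
    S <= 1 /\ 2 * eps + (L + 1) * S <= e.
Proof.
move=> T0 L0 K0 e0; set A := expR _; have A0 : 0 < A by exact: expR_gt0.
pose e2 := Num.min 1 (e / (2 * (L + 1))).
have L1 : 0 < L + 1 by rewrite ltr_wpDl.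
have e20 : 0 < e2 by rewrite lt_min ltr01/= divr_gt0// mulr_gt0.
have e21 : e2 <= 1 by rewrite ge_min lexx.
have e2e : (L + 1) * e2 <= e / 2.
  have : e2 <= e / (2 * (L + 1)) by rewrite ge_min lexx orbT.
  rewrite ler_pdivlMr ?mulr_gt0//; lra.
pose B := A * (T * (3 + T)).
have B0 : 0 < B by rewrite !mulr_gt0// addr_gt0.
pose eps := Num.min (e / 4) (e2 / (2 * B)).
have eps0 : 0 < eps by rewrite lt_min !divr_gt0// mulr_gt0.
have eps1 : 2 * eps <= e / 2.
  have : eps <= e / 4 by rewrite ge_min lexx.
  lra.
have eps2 : B * eps <= e2 / 2.
  have : eps <= e2 / (2 * B) by rewrite ge_min lexx orbT.
  rewrite ler_pdivlMr ?mulr_gt0//; lra.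
exists eps => //.
have c0 : A * (T / k%:R * K) @[k --> \oo] --> 0.
  have -> : (0 : R) = A * (0 * K) by rewrite mul0r mulr0.
  apply: cvgM; first exact: cvg_cst.
  by apply: cvgM; [exact: cvg_Tk|exact: cvg_cst].
have e22 : 0 < e2 / 2 by rewrite divr_gt0.
move/cvgrPdist_le : c0 => /(_ _ e22); apply: filterS => k.
rewrite sub0r normrN => /(le_trans (ler_norm _)) Hk.
set S := A * (T / k%:R * K + _).
have S2 : S <= e2.
  have -> : S = A * (T / k%:R * K) + B * eps by rewrite /S /B; ring.
  lra.
split; first exact: le_trans e21.
have : (L + 1) * S <= (L + 1) * e2 by rewrite ler_pM2l.
lra.
Qed.

End main_lemmas.

Unset Implicit Arguments.
Set Strict Implicit.

Theorem theorem4p1 (R : realType) (n m d s : nat) (T : R)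
    (g : 'I_s -> 'rV[R]_n -> R)
    (f1 : 'rV[R]_m -> 'rV[R]_n -> 'rV[R]_n)
    (f2 : 'rV[R]_d -> 'rV[R]_n -> 'rV[R]_n) (x0 : 'rV[R]_n)
    (xb yb ub : R -> 'rV[R]_n) (ab : R -> 'rV[R]_m) (bb : R -> 'rV[R]_d)
    (mesh : nat -> nat -> R)
    (hT : 0 < T) (h1 : H1 g) (h2 : H2 T g f1 f2)
    (hfeas : feasible T g f1 f2 x0 xb yb ub ab bb)
    (hBV : exists (mu : R) (vx vu : R -> 'rV[R]_n),
       [/\ 0 < mu, velocity_rep T xb vx, velocity_rep T ub vu
         & (maxe (vtotal_variation 0%R T vx) (vtotal_variation 0%R T vu)
              <= mu%:E)%E])
    (hmesh : forall k, (0 < k)%N -> is_mesh T k (mesh k)) :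
  exists (xk yk uk : nat -> R -> 'rV[R]_n) (ak : nat -> R -> 'rV[R]_m)
         (bk : nat -> R -> 'rV[R]_d),
    (forall k, (0 < k)%N ->
       [/\ piecewise_linear k (mesh k) (xk k),
           piecewise_linear k (mesh k) (yk k),
           piecewise_linear k (mesh k) (uk k),
           piecewise_linear k (mesh k) (ak k)
         & piecewise_linear k (mesh k) (bk k)] /\
       [/\ xk k 0 = x0, yk k 0 = 0, uk k 0 = ub 0, ak k 0 = ab 0
         & bk k 0 = bb 0] /\
       exists v w : nat -> 'rV[R]_n,
         [/\ linear_with_slopes k (mesh k) (xk k) v,
             linear_with_slopes k (mesh k) (yk k) w
           & forall j, (j < k)%N ->
               F1 g f1 (xk k (mesh k j)) (yk k (mesh k j.+1))
                 (uk k (mesh k j)) (ak k (mesh k j)) (- v j) /\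
               w j = f2 (bk k (mesh k j)) (xk k (mesh k j))]) /\
    W12_cvg T (fun k => quintuple (xk k) (yk k) (uk k) (ak k) (bk k))
      (quintuple xb yb ub ab bb).
Proof.
have T0 := ltW hT.
have [Wq feas xb0 C0 yb0] := hfeas.
have Wxyua := W12_row_mxl T0 Wq; have Wb := W12_row_mxr T0 Wq.
have Wxyu := W12_row_mxl T0 Wxyua; have Wa := W12_row_mxr T0 Wxyua.
have Wxy := W12_row_mxl T0 Wxyu; have Wu := W12_row_mxr T0 Wxyu.
have Wx := W12_row_mxl T0 Wxy; have Wy := W12_row_mxr T0 Wxy.
have Wab := W12_row_mx T0 Wa Wb.
have Wxi := W12_sub T0 Wx Wu.
pose xi r := xb r - ub r.
have [B B0 xB] := W12_bounded T0 Wx.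
pose r1 := B + 1.
have r10 : 0 <= r1 by rewrite addr_ge0.
have [L L0 lip] := H2_lip h2 Wab r10.
have [cf1 cf2 _ _] := h2.
have [mu0 [vx [vu [_ repx _ tv]]]] := hBV.
have tvx : (vtotal_variation 0%R T vx <= mu0%:E)%E.
  by apply: le_trans tv; rewrite le_max lexx.
have [G [Gmono Gosc]] := bv_majorant hT tvx.
pose phi r := f1 (ab r) (xb r) + yb r.
pose psi r := f2 (bb r) (xb r).
have cpsi : continuous (psi \o clamp T).
  exact: (continuous_pair_comp cf2 (W12_clamp_continuous T0 Wb)
    (W12_clamp_continuous T0 Wx)).
have cphi : continuous (phi \o clamp T).
  have c1 := continuous_pair_comp cf1 (W12_clamp_continuous T0 Wa)
    (W12_clamp_continuous T0 Wx).
  have c2 := W12_clamp_continuous T0 Wy.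
  by move=> r; exact: (cvgD (c1 r) (c2 r)).
(* points at which the nodes may be placed *)
pose good r := r \in `[0, T] ->
  [/\ F1 g f1 (xb r) (yb r) (ub r) (ab r) (- derive1 xb r),
      derive1 yb r = psi r & derive1 xb r = vx r].
have aegood : {ae @lebesgue_measure R, forall r : R, good r}.
  apply: ae_mono (ae_and feas repx) => r [H H'] rT; have [? ?] := H rT.
  by split => //; exact: H'.
have [tau Htau] := choose_nodes hmesh aegood Wxi.
(* distance between the velocity used at the initial point and vx 0 *)
pose M0 := `|- phi 0 - vx 0|.
(* q is the velocity corresponding to the normal vector - P used at step j: it
   is xb' (tau_j), except that the normal vector is 0 at the initial point *)
pose q k j := if j == 0%N then - phi 0 else derive1 xb (tau k j).
pose D k j := G (mesh k j.+1) - G (mesh k j) + (if j == 0%N then M0 else 0).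
pose K := G T - G 0 + M0.
pose P k j := if j == 0%N then 0 else derive1 xb (tau k j) + phi (tau k j).
pose h k j := mesh k j.+1 - mesh k j.
pose Z k j := traj (fun j => f1 (ab (mesh k j))) (fun j => f2 (bb (mesh k j)))
  (h k) (P k) x0 j.
pose X k j := (Z k j).1.
pose Y k j := (Z k j).2.
pose v k j := P k j - f1 (ab (mesh k j)) (X k j) - Y k j.+1.
pose w k j := f2 (bb (mesh k j)) (X k j).
pose node k j := xi (tau k j).
pose xk k := plin k (mesh k) x0 (v k).
pose yk k := plin k (mesh k) (0 : 'rV[R]_n) (w k).
pose ak k := plin k (mesh k) (ab 0) (slope (mesh k) (ab \o mesh k)).
pose bk k := plin k (mesh k) (bb 0) (slope (mesh k) (bb \o mesh k)).
pose Xi k := plin k (mesh k) (xi 0) (slope (mesh k) (node k)).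
(* x - u passes through the points xi (tau_j) of C *)
pose uk k r := xk k r - Xi k r.
have XS k j : X k j.+1 = X k j + (mesh k j.+1 - mesh k j) *: v k j by [].
have YS k j : Y k j.+1 = Y k j + (mesh k j.+1 - mesh k j) *: w k j by [].
have xkX k j : (0 < k)%N -> (j <= k)%N -> xk k (mesh k j) = X k j.
  move=> k0; elim: j => [|j IH] jk.
    by have [t0 _ _] := hmesh k k0; rewrite t0 /xk (plin0 k0 (hmesh k k0)).
  by rewrite /xk (plin_succ k0 (hmesh k k0))// -/(xk k) IH// ltnW.
have ykY k j : (0 < k)%N -> (j <= k)%N -> yk k (mesh k j) = Y k j.
  move=> k0; elim: j => [|j IH] jk.
    by have [t0 _ _] := hmesh k k0; rewrite t0 /yk (plin0 k0 (hmesh k k0)).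
  by rewrite /yk (plin_succ k0 (hmesh k k0))// -/(yk k) IH// ltnW.
have XiE k j : (0 < k)%N -> (j <= k)%N -> Xi k (mesh k j) = xi (tau k j).
  move=> k0 jk; have [tau0 _ _ _ _] := Htau k k0.
  rewrite /Xi /slope -[in xi 0]tau0.
  exact: (plin_nodes k0 (hmesh k k0) (node k) jk).
have akE k j : (0 < k)%N -> (j <= k)%N -> ak k (mesh k j) = ab (mesh k j).
  move=> k0 jk; have [t0 _ _] := hmesh k k0.
  rewrite /ak -[in ab 0]t0.
  exact: (plin_nodes k0 (hmesh k k0) (ab \o mesh k) jk).
have bkE k j : (0 < k)%N -> (j <= k)%N -> bk k (mesh k j) = bb (mesh k j).
  move=> k0 jk; have [t0 _ _] := hmesh k k0.
  rewrite /bk -[in bb 0]t0.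
  exact: (plin_nodes k0 (hmesh k k0) (bb \o mesh k) jk).
(* at j = 0 the vector 0 is normal; elsewhere translate the cone at tau_j *)
have normal k j : (0 < k)%N -> (j < k)%N ->
    normal_cone (Cmov g (X k j - xi (tau k j))) (X k j) (- P k j).
  move=> k0 jk; have [tau0 _ tauI taug _] := Htau k k0.
  have [j0|j0] := eqVneq j 0%N.
    rewrite /P j0 eqxx oppr0 tau0; apply: normal_cone0.
    by rewrite /xi /X /= xb0 subKr.
  have [|jr /(_ _) []] := taug j; first by rewrite lt0n j0.
    have := tauI j jk => /andP[a b]; rewrite in_itv/=.
    rewrite (le_trans (mesh_ge0 (hmesh k k0) (ltnW jk)) a)/=.
    by rewrite (le_trans b)// (mesh_leT (hmesh k k0)).
  move=> [nv Nnv Env] _ _.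
  have -> : - P k j = nv.
    rewrite /P (negbTE j0) opprD -Env /phi.
    by apply/matrixP => a b; rewrite !mxE; ring.
  have := normal_cone_shift (X k j - xb (tau k j)) Nnv.
  rewrite /xi (_ : ub (tau k j) + _ = X k j - (xb (tau k j) - ub (tau k j)));
    last first.
    by apply/matrixP => a b; rewrite !mxE; ring.
  by rewrite subrKC.
have M00 : 0 <= M0 by exact: normr_ge0.
have D0 k j : (0 < k)%N -> (j < k)%N -> 0 <= D k j.
  move=> k0 jk; have mk := hmesh k k0; apply: addr_ge0; last by case: ifP.
  rewrite subr_ge0; apply: Gmono; first exact: (mesh_ge0 mk (ltnW jk)).
    exact: (mesh_le mk (leqnSn j) jk).
  exact: (mesh_leT mk jk).
have DK k : (0 < k)%N -> \sum_(j < k) D k j <= K.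
  move=> k0; have mk := hmesh k k0; have [t0 tT _] := mk.
  rewrite big_split/= lerD//.
    rewrite -(big_mkord xpredT (fun j => G (mesh k j.+1) - G (mesh k j))).
    by rewrite (telescope_sumr (fun j => G (mesh k j)))// tT t0.
  case: (k) k0 => // k' _; rewrite big_ord_recl/= big1 ?addr0//.
have K0 : 0 <= K by rewrite addr_ge0// subr_ge0 Gmono.
have qD k : (0 < k)%N -> {ae @lebesgue_measure R, forall r : R, r \in `[0, T] ->
    forall j, (j < k)%N -> mesh k j < r < mesh k j.+1 ->
    `|q k j - derive1 xb r| <= D k j}.
  move=> k0; have mk := hmesh k k0; have [tau0 _ tauI taug _] := Htau k k0.
  apply: ae_mono repx => r rr rT j jk /andP[jr rj]; rewrite rr//.
  have a0 := mesh_ge0 mk (ltnW jk); have bT := mesh_leT mk jk.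
  have rI : mesh k j <= r <= mesh k j.+1 by rewrite !ltW.
  rewrite /q /D; have [j0|j0] := eqVneq j 0%N.
    rewrite -(subrKA (vx 0)) (le_trans (ler_normD _ _))// addrC lerD//.
    apply: Gosc => //; have [t0 _ _] := mk.
    by rewrite j0 t0 lexx -t0 (mesh_le mk)// -j0.
  have [|jtj] := taug j; first by rewrite lt0n j0.
  have tI := tauI j jk; move/andP: (tI) => [ta tb].
  have tT : tau k j \in `[0, T] by rewrite in_itv/= (le_trans a0)//= (le_trans tb).
  move=> /(_ tT)[_ _ ->]; rewrite addr0.
  exact: Gosc.
(* velocity estimate, from the error estimate on one mesh *)
have key e : 0 < e -> \forall k \near \oo, {ae @lebesgue_measure R, forall r : R,
    r \in `[0, T] -> forall j, (j < k)%N -> mesh k j < r < mesh k j.+1 ->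
    `|v k j - derive1 xb r| <= e + D k j /\ `|w k j - derive1 yb r| <= e}.
  move=> e0; have [eps eps0 Hpar] := small_params hT L0 K0 e0.
  have [dphi dphi0 Hd1] := unif_cont T cphi eps0.
  have [dpsi dpsi0 Hd2] := unif_cont T cpsi eps0.
  have [dyb dyb0 Hd3] := unif_cont T (W12_clamp_continuous T0 Wy) eps0.
  have d0 : 0 < Num.min dphi (Num.min dpsi dyb) by rewrite !lt_min dphi0 dpsi0.
  have /cvgrPdist_lt /(_ _ d0) Hk := cvg_Tk T.
  near=> k.
  have k0 : (0 < k)%N by near: k; exists 1%N.
  have mk := hmesh k k0; have [tau0 _ tauI _ _] := Htau k k0.
  have [S1 Se] : let S := expR ((2 * L + 1 + L * T) * T) *
      (T / k%:R * K + T * ((3 + T) * eps)) in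
    S <= 1 /\ 2 * eps + (L + 1) * S <= e by near: k.
  have hk : T / k%:R < Num.min dphi (Num.min dpsi dyb).
    have : `|0 - T / k%:R| < Num.min dphi (Num.min dpsi dyb) by near: k.
    by rewrite sub0r normrN; apply: le_lt_trans; exact: ler_norm.
  have modulus j r : (j < k)%N -> mesh k j <= r <= mesh k j.+1 ->
      [/\ `|phi r - phi (mesh k j)| <= eps, `|psi r - psi (mesh k j)| <= eps
        & `|yb r - yb (mesh k j)| <= eps].
    move=> jk /andP[jr rj]; have tT := mesh_itv mk (ltnW jk).
    have rT : r \in `[0, T].
      rewrite in_itv/= (le_trans (mesh_ge0 mk (ltnW jk)) jr)/=.
      by rewrite (le_trans rj)// (mesh_leT mk).
    have rd : `|r - mesh k j| < Num.min dphi (Num.min dpsi dyb).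
      apply: le_lt_trans hk; rewrite ger0_norm ?subr_ge0//.
      have [_ _ /(_ j jk)[_]] := mk; apply: le_trans.
      by rewrite lerD2r.
    move: rd; rewrite !lt_min => /and3P[rphi rpsi ryb]; split.
    - by have := Hd1 _ _ rT tT rphi; rewrite /= !clamp_id.
    - by have := Hd2 _ _ rT tT rpsi; rewrite /= !clamp_id.
    - by have := Hd3 _ _ rT tT ryb; rewrite /= !clamp_id.
  have H := @vw_close R n k T (mesh k) (fun r => f1 (ab r)) (fun r => f2 (bb r))
    xb yb (tau k) (D k) (q k) (X k) (Y k) (v k) (w k) L r1 eps K k0 mk Wx Wy L0
    (ltW eps0).
  have aey : {ae @lebesgue_measure R, forall r : R, r \in `[0, T] ->
      derive1 yb r = psi r}.
    by apply: ae_mono aegood => r gr rT; case: (gr rT).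
  have {}H := H aey.
  have xb_r1 r : r \in `[0, T] -> `|xb r| + 1 <= r1.
    by move=> rT; rewrite lerD2r; exact: xB.
  have {}H := H lip xb_r1.
  have {}H := H modulus tauI (qD k k0) (fun j => D0 k j k0) (DK k k0).
  have {}H := H (esym xb0) (esym yb0) (fun j _ => XS k j) (fun j _ => YS k j).
  have vE j : (j < k)%N -> v k j =
      q k j + phi (tau k j) - f1 (ab (mesh k j)) (X k j) - Y k j.+1.
    move=> jk; rewrite /v /P /q; case: eqP => // ->.
    by rewrite tau0 addNr.
  have {}H := H vE (fun j _ => erefl) S1.
  apply: ae_mono H => r H rT j jk jrj; have [Hv Hw] := H rT j jk jrj.
  split; first by rewrite (le_trans Hv)// lerD2r.
  exact: (le_trans Hw Se).
have cx : veldist_cvg T xk xb.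
  move=> i; have Wi := W12_coord i T0 Wx.
  have H : veldist T (splin k (mesh k) (x0 0 i) (fun j => v k j 0 i))
      (fun t => xb t 0 i)
      @[k --> \oo] --> 0.
    apply: (@veldist_step_cvg R T mesh hT hmesh _ (fun=> x0 0 i)
      (fun k j => v k j 0 i) D K Wi D0 DK).
    move=> e e0; have := key e e0; apply: filterS => k Hk.
    have [dx _ _ _] := Wx.
    apply: ae_mono (ae_and dx Hk) => r [dxr {}Hk] rT j jk jrj.
    have [Hv _] := Hk rT j jk jrj; apply: le_trans Hv.
    have := coord_le_norm (v k j - derive1 xb r) i; rewrite !mxE.
    by rewrite !derive1E derive_mx ?mxE//; exact: dxr.
  apply: eq_seq_cvg H => k; apply: eq_veldist => // r.
  by rewrite plin_coord.
have cy : veldist_cvg T yk yb.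
  move=> i; have Wi := W12_coord i T0 Wy.
  have H : veldist T (splin k (mesh k) 0 (fun j => w k j 0 i)) (fun t => yb t 0 i)
      @[k --> \oo] --> 0.
    apply: (@veldist_step_cvg R T mesh hT hmesh _ (fun=> 0)
      (fun k j => w k j 0 i) (fun _ _ => 0) 0 Wi).
    - by [].
    - by move=> k _; rewrite big1.
    move=> e e0; have := key e e0; apply: filterS => k Hk.
    have [dx _ _ _] := Wy.
    apply: ae_mono (ae_and dx Hk) => r [dxr {}Hk] rT j jk jrj; rewrite addr0.
    have [_ Hv] := Hk rT j jk jrj; apply: le_trans Hv.
    have := coord_le_norm (w k j - derive1 yb r) i; rewrite !mxE.
    by rewrite !derive1E derive_mx ?mxE//; exact: dxr.
  apply: eq_seq_cvg H => k; apply: eq_veldist => // r.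
  by rewrite plin_coord mxE.
have ca : veldist_cvg T ak ab by exact: interp_cvg.
have cb : veldist_cvg T bk bb by exact: interp_cvg.
have cXi : veldist_cvg T Xi xi.
  apply: (perturbed_interp_cvg (z_ := node) hT hmesh Wxi) => k j i k0 jk ik.
  by have [_ _ _ _] := Htau k k0; apply.
have Wplin k p (z0 : 'rV[R]_p) c : (0 < k)%N -> W12 T (plin k (mesh k) z0 c).
  by move=> k0; exact: (plin_W12 _ _ k0 (hmesh k k0)).
have Wxk k : (0 < k)%N -> W12 T (xk k) by exact: Wplin.
have Wyk k : (0 < k)%N -> W12 T (yk k) by exact: Wplin.
have Wak k : (0 < k)%N -> W12 T (ak k) by exact: Wplin.
have Wbk k : (0 < k)%N -> W12 T (bk k) by exact: Wplin.
have WXi k : (0 < k)%N -> W12 T (Xi k) by exact: Wplin.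
have Wuk k : (0 < k)%N -> W12 T (uk k).
  by move=> k0; exact: (W12_sub T0 (Wxk k k0) (WXi k k0)).
have cu : veldist_cvg T uk ub.
  move=> i.
  have := @veldist_sub_cvg R T (fun k t => xk k t 0 i) (fun k t => Xi k t 0 i)
    (fun t => xb t 0 i) (fun t => xi t 0 i) T0
    (W12_coord i T0 Wx) (W12_coord i T0 Wxi)
    (fun k k0 => W12_coord i T0 (Wxk k k0))
    (fun k k0 => W12_coord i T0 (WXi k k0))
    (cx i) (cXi i).
  apply: eq_seq_cvg => k; apply: eq_veldist => r; first by rewrite !mxE.
  by rewrite /xi !mxE; ring.
have init k : (0 < k)%N -> [/\ xk k 0 = x0, yk k 0 = 0, uk k 0 = ub 0,
    ak k 0 = ab 0 & bk k 0 = bb 0].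
  move=> k0; have mk := hmesh k k0.
  rewrite /uk /Xi /xk /yk /ak /bk !(plin0 k0 mk); split => //.
  by rewrite /xi xb0 subKr.
have slopes k (k0 : (0 < k)%N) p (z0 : 'rV[R]_p) c :
    linear_with_slopes k (mesh k) (plin k (mesh k) z0 c) c.
  exact: (plin_slopes k0 (hmesh k k0)).
exists xk, yk, uk, ak, bk; split.
  move=> k k0; split; last (split; first exact: init).
    split; [exists (v k)|exists (w k)
      |exists (fun j => v k j - slope (mesh k) (node k) j)
      |exists (slope (mesh k) (ab \o mesh k))
      |exists (slope (mesh k) (bb \o mesh k))];
      try exact: slopes.
    by apply: lws_sub; exact: slopes.
  exists (v k), (w k); split; [exact: slopes|exact: slopes|].
  move=> j jk; have jk' := ltnW jk.
  rewrite xkX// ykY// akE// bkE// /uk xkX// XiE//; split => //.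
  exists (- P k j); first exact: normal.
  by rewrite /v; apply/matrixP => a b; rewrite !mxE; ring.
apply: (W12_cvgI hT Wq).
- move=> k k0.
  exact: (W12_row_mx T0 (W12_row_mx T0 (W12_row_mx T0
    (W12_row_mx T0 (Wxk k k0) (Wyk k k0)) (Wuk k k0)) (Wak k k0)) (Wbk k k0)).
- move=> k k0; have [e1 e2 e3 e4 e5] := init k k0.
  by rewrite /quintuple e1 e2 e3 e4 e5 xb0 yb0.
- exact: (veldist_cvg_row_mx (veldist_cvg_row_mx (veldist_cvg_row_mx
    (veldist_cvg_row_mx cx cy) cu) ca) cb).
Unshelve. all: by end_near. Qed.
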